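(* Let $(G,\mathcal P,\delta)$ be a symmetric homogeneous Garside structure of finite type with set of atoms $\mathcal A$. Let $k,l$ be positive integers. When $k\ge 2$ in Part (a), or when $\max(k,l)\ge 2$ in Part (b), suppose in addition that the Garside structure is square free. Let $X\in G$ and $x,y\in\mathcal A$. Then: (a) $X\in (x^k)^G$ if and only if the left normal form of $X$ is $$\delta^{-n}\cdot A_n\cdot\dots\cdot A_2\cdot A_1\cdot x_1^{k}\cdot B_1\cdot B_2\cdot\dots\cdot B_n$$ for some $n\ge 0$, some $x_1\in x^G\cap\mathcal A$ and some simple elements $A_i,B_i$ such that $A_i\delta^{i-1}B_i=\delta^i$ for $i=1,\dots,n$. (b) $X\in (x^k)^G(y^l)^G$ if and only if either $X\in(x_1^ky_1^l)^G$ for some $x_1\in x^G\cap\mathcal A$, $y_1\in y^G\cap\mathcal A$, or every cycling orbit and every decycling orbit in the set of sliding circuits $SC(X)$ contains an element whose left normal form is $$\delta^{-n}\cdot A_n\cdot\dots\cdot A_2\cdot A_1\cdot x_1^{k}\cdot B_1\cdot B_2\cdot\dots\cdot B_n\cdot y_1^{l}$$ for some $n\ge1$, $x_1\in x^G\cap\mathcal A$, $y_1\in y^G\cap\mathcal A$, and some simple elements $A_i,B_i$ such that $A_i\delta^{i-1}B_i=\delta^i$ for $i=1,\dots,n$.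
   Context: Conjugation: $x^y=y^{-1}xy$, $x^G=\{x^z: z\in G\}$; $(x^k)^G(y^l)^G$ is the set of products of an element of $(x^k)^G$ and an element of $(y^l)^G$. A Garside structure $(G,\mathcal P,\delta)$ consists of a group $G$, a submonoid $\mathcal P$ with $\mathcal P\cap\mathcal P^{-1}=\{1\}$ and an element $\delta\in\mathcal P$ such that: (G1) the partial order $a\preccurlyeq b\iff a^{-1}b\in\mathcal P$ is a lattice order on $G$ (lcm $a\vee b$, gcd $a\wedge b$); (G2) the set of simple elements $[1,\delta]=\{a: 1\preccurlyeq a\preccurlyeq\delta\}$ generates $G$; (G3) $X\in\mathcal P\Rightarrow \delta^{-1}X\delta\in\mathcal P$; (G4) for $X\in\mathcal P\setminus\{1\}$, $\|X\|=\sup\{k: X=a_1\cdots a_k,\ a_i\in\mathcal P\setminus\{1\}\}<\infty$ (and $\|1\|=0$). It is of finite type if $[1,\delta]$ is finite. $]1,\delta[\,=[1,\delta]\setminus\{1,\delta\}$. An atom is an $a\in\mathcal P\setminus\{1\}$ such that $a=bc$ with $b,c\in\mathcal P$ implies $b=1$ or $c=1$; $\mathcal A$ is the set of atoms. Write $a\succcurlyeq b\iff ab^{-1}\in\mathcal P$. The structure is homogeneous if $\|XY\|=\|X\|+\|Y\|$ for all $X,Y\in\mathcal P$; symmetric if for all simple $u,v$ one has $u\preccurlyeq v\iff v\succcurlyeq u$; square free if no simple element can be written $Ux^2V$ with $U,V\in\mathcal P$, $x\in\mathcal A$. Put $\tau(X)=\delta^{-1}X\delta$ and $\partial A=A^{-1}\delta$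 for $A$ simple. For simple $A,B$ the product $A\cdot B$ is left weighted if $A=AB\wedge\delta$. The left normal form of $X\in G$ is the (unique) decomposition $X=\delta^p\cdot A_1\cdot\dots\cdot A_r$ with $p\in\mathbb Z$, $A_i\in\,]1,\delta[$ and each $A_i\cdot A_{i+1}$ left weighted; then $\inf X=p$, $\ell(X)=r$. In a left normal form, dots separate the simple factors, and $x^k$ stands for $x\cdot\dots\cdot x$ ($k$ factors). In (a) with $n=0$ the form is just $x_1^k$; in the degenerate case where $\delta$ is itself an atom (so $G\cong\mathbb Z$), the left normal form $\delta^k$ (with $p=k$, $r=0$) is regarded as being of this form with $n=0$, $x_1=\delta$. If $\ell(X)>0$ and $X=\delta^p\cdot A_1\cdot\dots\cdot A_r$ is the left normal form, put $\iota(X)=\tau^{-p}(A_1)$, $\varphi(X)=A_r$; the cycling is $\mathbf c(X)=X^{\iota(X)}$, the decycling is $\mathbf d(X)=X^{\varphi(X)^{-1}}$, the preferred prefix is $\mathfrak p(X)=\iota(X)\wedge\partial(\varphi(X))$ and the cyclic sliding is $\mathfrak s(X)=X^{\mathfrak p(X)}$. If $\ell(X)=0$, put $\mathbf c(X)=\mathbf d(X)=\mathfrak s(X)=X$. The set of sliding circuits is $SC(X)=\{Y\in X^G: \mathfrak s^m(Y)=Y\text{ for some }m>0\}$. For every $Y\in SC(X)$ there are $k,m>0$ with $\mathbf c^k(Y)=\mathbf d^m(Y)=Y$, and $SC(X)$ is stable under $\mathbf c$ and $\mathbf d$; the cycling orbit of $Y$ is $\{\mathbf c^k(Y):k\ge0\}$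 and the decycling orbit of $Y$ is $\{\mathbf d^k(Y):k\ge0\}$, so $SC(X)$ is a disjoint union of cycling orbits, and also of decycling orbits. *)

(* Defs.v *)
From mathcomp Require Import all_boot all_order.
From mathcomp Require Import ssralg ssrint.
From mathcomp Require Import boolp classical_sets functions cardinality.

Set Implicit Arguments.
Unset Strict Implicit.
Unset Printing Implicit Defensive.

Local Open Scope classical_set_scope.
Local Open Scope group_scope.

Definition expgz (G : groupType) (g : G) (p : int) : G :=
  match p with Posz n => g ^+ n | Negz n => g ^- n.+1 end.

Definition conj_class (G : groupType) (g : G) : set G :=
  [set g ^ z | z in [set: G]].

Definition set_mulg (G : groupType) (U V : set G) : set G :=
  [set u * v | u in U & v in V].

Definition pos_le (G : groupType) (P : set G) (a b : G) : Prop := P (a^-1 * b).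

Definition pos_interval (G : groupType) (P : set G) (d : G) : set G :=
  [set a | pos_le P 1 a /\ pos_le P a d].

(* For [X = 1] the only length is [0] (the empty product). *)
Definition factor_lengths (G : groupType) (P : set G) (X : G) : set nat :=
  [set size s | s in [set s : seq G |
     (forall a, a \in s -> P a /\ a <> 1) /\ X = \prod_(a <- s) a]].

(* [meet] and [join] are recorded as operations, but they are determined by
   [pos] since [pos_le pos] is a partial order. *)
Record garside (G : groupType) := Garside {
  pos : set G;
  delta : G;
  meet : G -> G -> G;
  join : G -> G -> G;
  pos1 : pos 1;
  posM : forall a b, pos a -> pos b -> pos (a * b);
  pos_anti : forall a, pos a -> pos a^-1 -> a = 1;
  pos_delta : pos delta;
  meetP : forall a b c,
    pos_le pos c (meet a b) <-> pos_le pos c a /\ pos_le pos c b;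
  joinP : forall a b c,
    pos_le pos (join a b) c <-> pos_le pos a c /\ pos_le pos b c;
  simple_gen : forall H : {pred G}, group_closed H ->
    (forall a, pos_interval pos delta a -> a \in H) -> forall g, g \in H;
  posJ_delta : forall a, pos a -> pos (a ^ delta);
  pos_bounded : forall a, pos a -> a <> 1 -> has_ubound (factor_lengths pos a)
}.

Section GarsideNotions.
Variables (G : groupType) (S : garside G).
Implicit Types (a b u v x X Y : G) (A B : nat -> G).

Local Notation P := (pos S).
Local Notation d := (delta S).

Definition prefix_le a b : Prop := pos_le P a b.
Definition suffix_ge a b : Prop := P (a * b^-1).

Definition simples : set G := pos_interval P d.
Definition proper_simples : set G := simples `\` [set 1; d].

Definition atoms : set G :=
  [set a | [/\ P a, a <> 1 &
    forall b c, P b -> P c -> a = b * c -> b = 1 \/ c = 1]].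

Definition norm X : nat := supremum 0%N (factor_lengths P X).

Definition finite_type : Prop := finite_set simples.

Definition homogeneous : Prop :=
  forall X Y, P X -> P Y -> norm (X * Y) = (norm X + norm Y)%N.

Definition garside_symmetric : Prop :=
  forall u v, simples u -> simples v -> (prefix_le u v <-> suffix_ge v u).

Definition square_free : Prop :=
  forall U V x, P U -> P V -> atoms x -> ~ simples (U * x ^+ 2 * V).

Definition right_compl a : G := a^-1 * d.

Definition left_weighted a b : Prop := a = meet S (a * b) d.

Definition is_left_normal_form X (p : int) (s : seq G) : Prop :=
  [/\ X = expgz d p * \prod_(a <- s) a,
      forall a, a \in s -> proper_simples a &
      forall i, (i.+1 < size s)%N -> left_weighted s`_i s`_i.+1].

(* The default value is never used: every element has a unique left normal
   form. *)
Definition left_normal_form X : int * seq G :=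
  xget (Posz 0, [::]) [set ps | is_left_normal_form X ps.1 ps.2].

Definition lnf_inf X : int := (left_normal_form X).1.
Definition ell X : nat := size (left_normal_form X).2.

(* The inverse conjugation [tau^-p] by [delta ^ p], applied to the first
   factor. *)
Definition initial_factor X : G :=
  head 1 (left_normal_form X).2 ^ expgz d (- lnf_inf X)%R.
Definition final_factor X : G := last 1 (left_normal_form X).2.

Definition preferred_prefix X : G :=
  meet S (initial_factor X) (right_compl (final_factor X)).

Definition cycling X : G :=
  if (0 < ell X)%N then X ^ initial_factor X else X.
Definition decycling X : G :=
  if (0 < ell X)%N then X ^ (final_factor X)^-1 else X.
Definition sliding X : G :=
  if (0 < ell X)%N then X ^ preferred_prefix X else X.

Definition sliding_circuits X : set G :=
  [set Y | conj_class X Y /\ exists2 m, (0 < m)%N & iter m sliding Y = Y].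

Definition cycling_orbit Y : set G := [set iter m cycling Y | m in [set: nat]].
Definition decycling_orbit Y : set G :=
  [set iter m decycling Y | m in [set: nat]].

Definition compl_factors (n : nat) A B : Prop :=
  forall i, (1 <= i <= n)%N ->
    [/\ simples (A i), simples (B i) & A i * d ^+ i.-1 * B i = d ^+ i].

(* A_n, ..., A_1, x, ..., x (k times), B_1, ..., B_n *)
Definition sandwich (n k : nat) A B x : seq G :=
  [seq A i | i <- rev (iota 1 n)] ++ nseq k x ++ [seq B i | i <- iota 1 n].

(* The second alternative only occurs when [delta] is an atom: the left normal
   form of [delta ^+ k] is then [delta ^+ k] with no proper simple factor, and
   it counts as the form with [n = 0] and [x1 = delta]. *)
Definition power_form (k : nat) x X : Prop :=
  (exists n x1 A B,
     [/\ (conj_class x `&` atoms) x1, compl_factors n A B &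
         is_left_normal_form X (- Posz n)%R (sandwich n k A B x1)])
  \/ ((conj_class x `&` atoms) d /\ is_left_normal_form X (Posz k) [::]).

Definition product_form (k l : nat) x y X : Prop :=
  exists n x1 y1 A B,
    [/\ (1 <= n)%N, (conj_class x `&` atoms) x1, (conj_class y `&` atoms) y1,
        compl_factors n A B &
        is_left_normal_form X (- Posz n)%R
          (sandwich n k A B x1 ++ nseq l y1)].

End GarsideNotions.

(* Main.v *)
Require Import Defs.
From mathcomp Require Import all_boot all_order.
From mathcomp Require Import ssralg ssrnum ssrint.
From mathcomp Require Import boolp classical_sets functions cardinality.
From mathcomp Require Import zify.

(* The elements [g] are used as positions: [X ^ g] is the conjugate of [X] seen
   from [g], and [g] is prefix-ordered with lattice operations. Cycling,
   decycling and cyclic sliding come from maps of positions ([kap], [dec],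
   [sig]) built from left multiplication by [X] or its inverse, right
   multiplication by powers of [delta] and meets; hence these maps are monotone
   and commute, and in length at least 2 sliding is cycling after decycling.

   (a) Write the conjugate as [(x1 ^+ k) ^ V] with [V] positive of minimal norm.
   Symmetry turns any failure of a weighting condition between [x1] and the
   first factor of [V] into an exchange [x1 e = e x2] that shortens [V], so the
   normal forms of [V^-1] and [V] surround [x1 ^+ k] to give a normal form.

   (b) Let [X = P1 * P2]. Take a position [t] where [P2 ^ t] is a power of an
   atom [y1] and the depth [N] of [P1 ^ t] is minimal. If [N = 0], then [X] is
   conjugate to [x1 ^+ k * y1 ^+ l]; otherwise minimality makes [X ^ t] a
   product form, decycling moves [t] to [t * y1^-1], and such positions are
   stable under sliding. If [g <= t <= g * delta] and [X ^ g] has inf at least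
   [- N] and sup at most [N + k + l], then comparing [dec g] with [dec t] shows
   that [P2] is already a power of an atom at [g] or at [dec g]; the bound on
   inf then forces such a position to be [t' * y' ^- i] with [t'] of the same
   kind as [t] and [i <= l], and [i] cyclings lead back to a product form.
   Chains [meet t (g * delta ^+ i)] extend this to all [g] satisfying the
   bounds. Elements of sliding circuits satisfy them, since otherwise their
   cycling (or decycling) orbit would drift away from that of [t]. *)

Set Implicit Arguments.
Unset Strict Implicit.
Unset Printing Implicit Defensive.

Import GRing.Theory.

Local Open Scope classical_set_scope.
Local Open Scope group_scope.

Ltac grp :=
  by rewrite ?conjgE !(invgM, invgK, invg1, mulgA, mulg1, mul1g, mulgK, mulgVK, mulgV, mulVg).

Lemma pigeonhole (T : eqType) (s : seq T) (f : nat -> T) :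
  (forall i, f i \in s) -> exists i j, (i < j)%N /\ f i = f j.
Proof.
move=> fs; pose t := mkseq f (size s).+1.
have /(uniqPn (f 0%N)) [i [j [ij js ijE]]] : ~~ uniq t.
  apply/negP => ut; have := uniq_leq_size ut (s2 := s).
  rewrite size_mkseq ltnn => H; suff : false by [].
  by apply: H => _ /mapP[i _ ->].
rewrite size_mkseq in js; exists i, j; split=> //.
by rewrite !nth_mkseq // in ijE; exact: ltn_trans ij js.
Qed.

(** * Integer powers of a group element *)

Section IntegerPowers.
Variables (G : groupType) (g : G).
Implicit Types a b : int.

Lemma expgz1D a : expgz g (a + 1)%R = expgz g a * g.
Proof.
case: a => [n|[|n]].
- have -> : (Posz n + 1)%R = Posz n.+1 by lia.
  by rewrite /= expgSr.
- have -> : (Negz 0 + 1)%R = Posz 0 by lia.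
  by rewrite /= expg0 expg1 mulVg.
- have -> : (Negz n.+1 + 1)%R = Negz n by lia.
  by rewrite /= [g ^+ n.+2]expgS invgM mulgVK.
Qed.

Lemma expgzD a b : expgz g (a + b)%R = expgz g a * expgz g b.
Proof.
have up n c : expgz g (c + Posz n)%R = expgz g c * g ^+ n.
  elim: n => [|n IH]; first by rewrite expg0 mulg1; congr expgz; lia.
  have -> : (c + Posz n.+1)%R = ((c + Posz n) + 1)%R by lia.
  by rewrite expgz1D IH -mulgA expgSr.
case: b => n; first exact: up.
apply: (mulIg (g ^+ n.+1)); rewrite -up /= mulgVK.
by congr expgz; lia.
Qed.

Lemma expgzN a : expgz g (- a)%R = (expgz g a)^-1.
Proof.
by apply: (mulIg (expgz g a)); rewrite -expgzD mulVg; have -> : (- a + a = 0)%R by lia.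
Qed.

Lemma expgz0 : expgz g 0%R = 1. Proof. exact: expg0. Qed.

Lemma expgz1 : expgz g 1%R = g. Proof. exact: expg1. Qed.

End IntegerPowers.

(** * The prefix order as a lattice order invariant under left multiplication *)

Section Order.
Variables (G : groupType) (S : garside G).
Implicit Types (a b c g h : G) (z t : int).

Local Notation P := (pos S).
Local Notation d := (delta S).
Local Notation D := (expgz (delta S)).
Local Notation le := (prefix_le S).
Local Notation meet := (meet S).
Local Notation join := (join S).

Lemma le_refl a : le a a.
Proof. by rewrite /prefix_le /pos_le mulVg; exact: pos1. Qed.

Lemma le_trans b a c : le a b -> le b c -> le a c.
Proof.
rewrite /prefix_le /pos_le => ab bc.
have -> : a^-1 * c = (a^-1 * b) * (b^-1 * c) by grp.
  by apply: posM.
Qed.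

Lemma le_anti a b : le a b -> le b a -> a = b.
Proof.
rewrite /prefix_le /pos_le => ab ba; apply/esym.
have: a^-1 * b = 1 by apply: (@pos_anti _ S) => //; rewrite invgM invgK.
by move=> H; rewrite -[b](mulVKg a) H mulg1.
Qed.

Lemma le_mul2l c a b : le (c * a) (c * b) <-> le a b.
Proof. by rewrite /prefix_le /pos_le; have -> : (c * a)^-1 * (c * b) = a^-1 * b by grp. Qed.

Lemma le_mul a b : P b -> le a (a * b).
Proof. by rewrite /prefix_le /pos_le mulKg. Qed.

Lemma le1 a : le 1 a <-> P a.
Proof. by rewrite /prefix_le /pos_le invg1 mul1g; split. Qed.

Lemma le_meet a b c : le c (meet a b) <-> le c a /\ le c b.
Proof. exact: meetP. Qed.

Lemma meet_lel a b : le (meet a b) a.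
Proof. by have /meetP[] := le_refl (meet a b). Qed.

Lemma meet_ler a b : le (meet a b) b.
Proof. by have /meetP[] := le_refl (meet a b). Qed.

Lemma le_joinl a b : le a (join a b).
Proof. by have /joinP[] := le_refl (join a b). Qed.

Lemma le_joinr a b : le b (join a b).
Proof. by have /joinP[] := le_refl (join a b). Qed.

Lemma join_le a b c : le a c -> le b c -> le (join a b) c.
Proof. by move=> ac bc; apply/joinP. Qed.

Lemma le_ext a b : (forall c, le c a <-> le c b) -> a = b.
Proof. by move=> H; apply: le_anti; apply/H; exact: le_refl. Qed.

Lemma meetMl c a b : c * meet a b = meet (c * a) (c * b).
Proof.
apply: le_ext => e.
by rewrite -[e](mulVKg c) le_mul2l !le_meet !le_mul2l; split.
Qed.

Lemma meetC a b : meet a b = meet b a.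
Proof. by apply: le_ext => e; split=> /le_meet[? ?]; apply/le_meet. Qed.

Lemma meetA a b c : meet a (meet b c) = meet (meet a b) c.
Proof.
by apply: le_ext => e; rewrite !le_meet; split; tauto.
Qed.

Lemma meet_idl a b : le a b -> meet a b = a.
Proof.
move=> ab; apply: le_anti; first exact: meet_lel.
by apply/le_meet; split=> //; exact: le_refl.
Qed.

Lemma meet_idr a b : le b a -> meet a b = b.
Proof. by move=> ba; rewrite meetC meet_idl. Qed.

Lemma meet_mono a b a' b' : le a a' -> le b b' -> le (meet a b) (meet a' b').
Proof.
move=> aa' bb'; apply/le_meet; split.
  by apply: le_trans aa'; exact: meet_lel.
by apply: le_trans bb'; exact: meet_ler.
Qed.

End Order.

(** * Conjugation by [delta] and right multiplication by its powers *)

Section Conjugation.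
Variables (G : groupType) (S : garside G).
Hypothesis fin : finite_type S.
Implicit Types (a b c g h : G) (z t : int).

Local Notation P := (pos S).
Local Notation d := (delta S).
Local Notation D := (expgz (delta S)).
Local Notation le := (prefix_le S).
Local Notation meet := (meet S).
Local Notation join := (join S).

Lemma simple_conj_delta a : simples S a -> simples S (a ^ d).
Proof.
case=> /le1 pa ad; split; first by apply/le1; exact: posJ_delta.
rewrite /pos_le; have -> : (a ^ d)^-1 * d = (a^-1 * d) ^ d by grp.
exact: posJ_delta.
Qed.

(* The [tau]-periodic elements form a subgroup, which contains the finitely
   many simple elements. *)
Lemma conj_delta_periodic g : exists2 n, (0 < n)%N & g ^ (d ^+ n) = g.
Proof.
pose H : {pred G} := [pred g | `[< exists2 n, (0 < n)%N & g ^ (d ^+ n) = g >]].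
have HP x : reflect (exists2 n, (0 < n)%N & x ^ (d ^+ n) = x) (x \in H).
  by rewrite inE; apply: asboolP.
suff /HP : g \in H by [].
have iterJ x n m : x ^ (d ^+ n) = x -> x ^ (d ^+ (n * m)) = x.
  move=> xn; elim: m => [|m IH]; first by rewrite muln0 expg0 conjg1.
  by rewrite mulnS expgnDr conjgM xn.
apply: (@simple_gen _ S); last first.
  move=> a sa; apply/HP.
  have [s sE] := (finite_seqP _).1 fin.
  have sP x : simples S x <-> x \in s by rewrite sE.
  have sJ i : a ^ (d ^+ i) \in s.
    apply/sP; elim: i => [|i IH]; first by rewrite expg0 conjg1.
    by rewrite expgSr conjgM; apply: simple_conj_delta.
  have [i [j [ij ijE]]] := pigeonhole sJ.
  exists (j - i)%N; first by rewrite subn_gt0.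
  apply: (conjg_inj (d ^+ i)); rewrite -conjgM -expgnDr subnK //.
  exact: ltnW.
split; first by apply/HP; exists 1%N => //; rewrite conj1g.
move=> x y /HP[n n0 xn] /HP[m m0 ym]; apply/HP.
exists (n * m)%N; first by rewrite muln_gt0 n0.
by rewrite conjMg conjVg iterJ // mulnC iterJ.
Qed.

Lemma pos_conjX a n : P a -> P (a ^ (d ^+ n)).
Proof.
move=> pa; elim: n => [|n IH]; first by rewrite expg0 conjg1.
by rewrite expgSr conjgM; apply: posJ_delta.
Qed.

(** The axiom covers conjugation by [delta] in one direction only. Since every element has a finite
    [tau]-orbit, conjugation by [delta^-1] acts on it as a nonnegative power of [tau]. *)
Lemma pos_conj a z : P a -> P (a ^ D z).
Proof.
move=> pa; case: z => n; first exact: pos_conjX.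
rewrite /=; move: n.+1 => {}n.
elim: n => [|n IH]; first by rewrite expg0 invg1 conjg1.
have [[//|m] _ mE] := conj_delta_periodic (a ^ (d ^- n)).
have -> : a ^ (d ^- n.+1) = (a ^ (d ^- n)) ^ (d ^+ m).
  apply: (conjg_inj d); rewrite -[RHS]conjgM -expgSr mE -conjgM.
  by congr (_ ^ _); rewrite expgS invgM mulgVK.
exact: pos_conjX.
Qed.

(** The order is left invariant by definition; right invariance under powers of [delta] is
    [pos_conj]. *)
Lemma le_mulD a b z : le (a * D z) (b * D z) <-> le a b.
Proof.
have up x y t : le x y -> le (x * D t) (y * D t).
  rewrite /prefix_le /pos_le => xy.
  have -> : (x * D t)^-1 * (y * D t) = (x^-1 * y) ^ D t by grp.
  exact: pos_conj.
by split=> [/(up _ _ (- z)%R)|]; [rewrite expgzN !mulgK | exact: up].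
Qed.

Lemma meetMD a b z : meet a b * D z = meet (a * D z) (b * D z).
Proof.
apply: (le_ext (S := S)) => e.
by rewrite -[e](mulgVK (D z)) le_mulD !le_meet !le_mulD; split.
Qed.

Lemma le_mulDr a b (z : nat) : le a b -> le a (b * D (Posz z)).
Proof.
move=> ab; apply: le_trans ab _; apply: le_mul.
elim: z => [|z IH]; first exact: pos1.
by rewrite /= expgSr; apply: posM => //; exact: pos_delta.
Qed.

Lemma le_mulD2 a z t : (z <= t)%R -> le (a * D z) (a * D t).
Proof.
move=> zt; have -> : t = (z + Posz `|t - z|%N)%R by lia.
by rewrite expgzD mulgA; apply: le_mulDr; exact: le_refl.
Qed.

Lemma le_D2 z t : (z <= t)%R -> le (D z) (D t).
Proof. by move=> zt; rewrite -[D z]mul1g -[D t]mul1g; exact: le_mulD2. Qed.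

(** The elements caught between two powers of [delta] form a subgroup that contains the simple
    elements. *)
Lemma le_bounded g : exists n : nat, le g (D (Posz n)) /\ le (D (- Posz n)%R) g.
Proof.
pose Q g := exists n : nat, le g (D (Posz n)) /\ le (D (- Posz n)%R) g.
pose H : {pred G} := [pred g | `[< Q g >]].
have HP x : reflect (Q x) (x \in H) by rewrite inE; apply: asboolP.
have Qw n m x : (n <= m)%N -> le x (D (Posz n)) /\ le (D (- Posz n)%R) x ->
    le x (D (Posz m)) /\ le (D (- Posz m)%R) x.
  move=> nm [h1 h2]; split.
    by apply: le_trans h1 _; apply: le_D2; lia.
  by apply: le_trans _ h2; apply: le_D2; lia.
suff /HP : g \in H by [].
apply: (@simple_gen _ S); last first.
  move=> a [/le1 pa ad]; apply/HP; exists 1%N; rewrite expgz1; split=> //.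
  apply: (@le_trans _ _ 1); last exact/le1.
  rewrite -(expgz0 d); apply: le_D2; lia.
split; first by apply/HP; exists 0%N; split; exact: le_refl.
move=> x y /HP[n [xn nx]] /HP[m [ym my]]; apply/HP; exists (n + m)%N.
have [vm mv] : le y^-1 (D (Posz m)) /\ le (D (- Posz m)%R) y^-1.
  split; apply/(le_mul2l _ y); rewrite mulgV.
    apply/(le_mulD _ _ (- Posz m)%R); rewrite mul1g -mulgA -expgzD.
    by rewrite subrr mulg1.
  apply/(le_mulD _ _ (Posz m)%R); rewrite mul1g -mulgA -expgzD.
  by rewrite addNr mulg1.
split.
  apply: (@le_trans _ _ (x * D m)); first by apply/le_mul2l.
  by rewrite PoszD expgzD; apply/le_mulD.
apply: (@le_trans _ _ (x * D (- Posz m)%R)); last by apply/le_mul2l.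
have -> : (- Posz (n + m) = - Posz n + - Posz m)%R by lia.
by rewrite expgzD; apply/le_mulD.
Qed.

End Conjugation.

(** * Homogeneity and symmetry: additive degree, atoms, simple elements, exchanges *)

Section Degree.
Variables (G : groupType) (S : garside G).
Hypotheses (fin : finite_type S) (hom : homogeneous S).
Implicit Types (a b c g h x y : G) (z t : int).

Local Notation P := (pos S).
Local Notation d := (delta S).
Local Notation D := (expgz (delta S)).
Local Notation le := (prefix_le S).
Local Notation meet := (meet S).
Local Notation join := (join S).

Lemma pos_D (n : nat) : P (D (Posz n)).
Proof. by apply/le1; rewrite -(mul1g (D _)); apply: le_mulDr; apply: le_refl. Qed.

Lemma norm1 : norm S 1 = 0%N.
Proof. by have := hom (pos1 S) (pos1 S); rewrite mulg1; lia. Qed.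

Lemma norm_gt0 a : P a -> a <> 1 -> (0 < norm S a)%N.
Proof.
move=> pa a1; have := @ge_supremum_Nmem _ _ 0%N (factor_lengths P a) 1%N.
rewrite leEnat; apply; first exact/nat_supremums_neq0/(pos_bounded pa).
by exists [:: a] => //; split; [move=> b; rewrite inE => /eqP-> | rewrite big_seq1].
Qed.

Lemma norm_eq0 a : P a -> norm S a = 0%N -> a = 1.
Proof. by move=> pa a0; apply: contrapT => /(norm_gt0 pa); rewrite a0. Qed.

Lemma pos_prod (s : seq G) : (forall a, a \in s -> P a) -> P (\prod_(a <- s) a).
Proof.
elim: s => [|a s IH] sP; first by rewrite big_nil; exact: pos1.
rewrite big_cons; apply: posM; first by apply: sP; rewrite mem_head.
by apply: IH => b bs; apply: sP; rewrite inE bs orbT.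
Qed.

Lemma pos_mul_eq1 a b : P a -> P b -> a * b = 1 -> a = 1.
Proof.
move=> pa pb ab; apply: (pos_anti pa).
by rewrite (mulg1_eq ab).
Qed.

Lemma norm_atom a : atoms S a -> norm S a = 1%N.
Proof.
case=> pa a1 aP; have := norm_gt0 pa a1.
suff : (norm S a <= 1)%N by lia.
rewrite /norm /supremum; case: ifP => // _.
have [_] : supremums (factor_lengths P a) (xget 0%N (supremums (factor_lengths P a))).
  by apply: xgetPex; apply: nat_supremums_neq0; apply: pos_bounded.
apply; move=> _ [s [sP sE] <-]; rewrite leEnat.
case: s sP sE => [|b [|c s]] // sP sE; exfalso.
have [pb b1] : P b /\ b <> 1 by apply: sP; rewrite mem_head.
have [pc c1] : P c /\ c <> 1 by apply: sP; rewrite !inE eqxx orbT.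
have ps : P (\prod_(i <- s) i).
  by apply: pos_prod => e es; have [] := sP e; rewrite // !inE es !orbT.
move: sE; rewrite !big_cons => /aP[//||//|] ; first exact: posM.
by move/(pos_mul_eq1 pc ps).
Qed.

(** The norm extended to a homomorphism into the integers: some power of [delta] makes [g] positive,
    and its contribution is subtracted again. By [degreeE] the choice of [n] does not matter. *)
Definition degree g : int :=
  let n := xget 0%N [set n : nat | P (g * D (Posz n))] in
  (Posz (norm S (g * D (Posz n))) - Posz (n * norm S d))%R.

Lemma pos_mulD_ex g : exists n : nat, P (g * D (Posz n)).
Proof.
have [n [_ h]] := le_bounded fin g; exists n; apply/le1.
have := (le_mulD fin (D (- Posz n)%R) g (Posz n)).2 h.
by rewrite -expgzD addNr expgz0.
Qed.

Lemma norm_D (n : nat) : norm S (D (Posz n)) = (n * norm S d)%N.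
Proof.
elim: n => [|n IH]; first by rewrite expgz0 norm1.
have -> : Posz n.+1 = (Posz n + 1)%R by lia.
rewrite expgz1D hom ?IH; last 2 first.
- exact: pos_D.
- exact: pos_delta.
lia.
Qed.

Lemma degreeE (n : nat) g : P (g * D (Posz n)) ->
  degree g = (Posz (norm S (g * D (Posz n))) - Posz (n * norm S d))%R.
Proof.
have step m k : P (g * D (Posz m)) ->
    norm S (g * D (Posz (m + k))) = (norm S (g * D (Posz m)) + k * norm S d)%N.
  by move=> pm; rewrite PoszD expgzD mulgA (hom pm (pos_D k)) norm_D.
move=> pn; rewrite /degree; set m := xget _ _.
have pm : P (g * D (Posz m)) by apply: (@xgetPex _ 0%N [set n | P (g * D (Posz n))]); exists n.
have := step _ (m - n)%N pn; have := step _ (n - m)%N pm.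
have [nm|mn] := leqP n m.
  have -> : (n + (m - n))%N = m by lia.
  move=> _ ->; nia.
have -> : (m + (n - m))%N = n by lia.
move=> -> _; nia.
Qed.

Lemma norm_conj a (n : nat) : P a -> norm S (a ^ D (Posz n)) = norm S a.
Proof.
move=> pa; have pc : P (a ^ D (Posz n)) by exact: pos_conj.
have := congr1 (norm S) (conjgC a (D (Posz n))).
by rewrite (hom pa (pos_D n)) (hom (pos_D n) pc); lia.
Qed.

Lemma degree_pos a : P a -> degree a = Posz (norm S a).
Proof. by move=> pa; rewrite (@degreeE 0%N) expgz0 mulg1 //; lia. Qed.

(** Moving a power of [delta] across [h] conjugates it, which leaves its norm unchanged by
    [norm_conj]. *)
Lemma degreeM g h : degree (g * h) = (degree g + degree h)%R.
Proof.
have [n pn] := pos_mulD_ex g; have [m pm] := pos_mulD_ex h.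
have E : g * h * D (Posz (m + n)) = (g * D (Posz n)) * (h * D (Posz m)) ^ D (Posz n).
  by rewrite PoszD expgzD; grp.
have pc := pos_conj fin (Posz n) pm.
rewrite (@degreeE (m + n)) E; last by apply: posM.
by rewrite hom // norm_conj // (degreeE pn) (degreeE pm); lia.
Qed.

Lemma degree1 : degree 1 = 0%R.
Proof. by rewrite degree_pos ?norm1 //; exact: pos1. Qed.

Lemma degreeV g : degree g^-1 = (- degree g)%R.
Proof. by have := degreeM g^-1 g; rewrite mulVg degree1; lia. Qed.

Lemma degreeJ g h : degree (g ^ h) = degree g.
Proof. by rewrite conjgE !degreeM degreeV; lia. Qed.

Lemma degreeX g n : degree (g ^+ n) = (degree g * Posz n)%R.
Proof.
elim: n => [|n IH]; first by rewrite expg0 degree1; lia.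
by rewrite expgS degreeM IH; lia.
Qed.

Lemma degreeD z : degree (D z) = (degree d * z)%R.
Proof. by case: z => n; rewrite /= ?degreeV degreeX //; lia. Qed.

Lemma degree_ge0 a : P a -> (0 <= degree a)%R.
Proof. by move=> /degree_pos ->. Qed.

Lemma degree_eq0 a : P a -> degree a = 0%R -> a = 1.
Proof. by move=> pa; rewrite degree_pos // => /eqP; rewrite eqz_nat => /eqP /(norm_eq0 pa). Qed.

Lemma degree_gt0 a : P a -> a <> 1 -> (0 < degree a)%R.
Proof. by move=> pa a1; rewrite degree_pos //; have := norm_gt0 pa a1; lia. Qed.

Lemma le_degree a b : le a b -> (degree a <= degree b)%R.
Proof. by move=> /degree_ge0; rewrite degreeM degreeV; lia. Qed.

Lemma le_degree_eq a b : le a b -> degree a = degree b -> a = b.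
Proof.
move=> ab E; have := degree_eq0 ab; rewrite degreeM degreeV E addNr => /(_ erefl) H.
by rewrite -(mulVKg a b) H mulg1.
Qed.

(** Each nontrivial positive factor has degree at least 1. Since conjugation preserves the degree, a
    conjugate of an atom is an atom as soon as it is positive. *)
Lemma atomsE a : atoms S a <-> P a /\ degree a = 1%R.
Proof.
split=> [aa|[pa a1]].
  have pa : P a by case: aa.
  by split=> //; rewrite degree_pos // norm_atom.
split=> //; first by move=> E; rewrite E degree1 in a1.
move=> b c pb pc E; move: a1; rewrite E degreeM => H.
have := degree_ge0 pb; have := degree_ge0 pc.
have [->|/eqP b1] := eqVneq b 1; first by left.
have [->|/eqP c1] := eqVneq c 1; first by right.
by have := degree_gt0 pb b1; have := degree_gt0 pc c1; lia.
Qed.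

Lemma atom_pos a : atoms S a -> P a.
Proof. by case. Qed.

Lemma atom_degree a : atoms S a -> degree a = 1%R.
Proof. by case/atomsE. Qed.

Lemma atom_conjD a z : atoms S a -> atoms S (a ^ D z).
Proof. by move/atomsE=> [pa a1]; apply/atomsE; rewrite degreeJ; split=> //; exact: pos_conj. Qed.

Lemma le_atom b a : atoms S a -> P b -> le b a -> b = 1 \/ b = a.
Proof.
case=> _ _ aP pb ba; have [->|H] := aP b (b^-1 * a) pb ba (esym (mulVKg b a)); first by left.
by right; rewrite -[b]mulg1 -H mulVKg.
Qed.

Lemma le_mul_atom b c a : atoms S a -> le b c -> le c (b * a) -> c = b \/ c = b * a.
Proof.
move=> aa bc ca; have [|E|E] := @le_atom (b^-1 * c) a aa bc.
- by apply/(le_mul2l _ b); rewrite mulVKg.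
- by left; rewrite -(mulVKg b c) E mulg1.
- by right; rewrite -(mulVKg b c) E.
Qed.

Lemma atom_below g : P g -> g <> 1 -> exists2 a, atoms S a & le a g.
Proof.
move=> pg; have [n] := ubnP (norm S g); elim: n g pg => // n IH g pg gn g1.
have [ag|ag] := pselect (atoms S g); first by exists g => //; exact: le_refl.
have [b [c [pb pc E [b1 c1]]]] : exists b c, [/\ P b, P c, g = b * c & b <> 1 /\ c <> 1].
  apply: contrapT => H; apply: ag; split=> // b c pb pc E.
  apply: contrapT => /not_orP[b1 c1]; apply: H; by exists b, c.
have gc := norm_gt0 pc c1.
have [|a aa ab] := IH b pb _ b1; first by move: gn; rewrite E hom //; lia.
by exists a => //; apply: le_trans ab _; rewrite E; exact: le_mul.
Qed.

Lemma simplesE a : simples S a <-> P a /\ le a d.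
Proof. by split=> [[/le1]|[pa ad]] //; split=> //; apply/le1. Qed.

Lemma simple_pos a : simples S a -> P a.
Proof. by case/simplesE. Qed.

Lemma simple_le a : simples S a -> le a d.
Proof. by case/simplesE. Qed.

Lemma simple_prefix a b : P a -> le a b -> simples S b -> simples S a.
Proof. by move=> pa ab /simplesE[_ bd]; apply/simplesE; split=> //; exact: le_trans ab bd. Qed.

Lemma simple_mull a b : P a -> P b -> simples S (a * b) -> simples S a.
Proof. by move=> pa pb; apply: simple_prefix => //; exact: le_mul. Qed.

Lemma pos_compl a : simples S a -> P (right_compl S a).
Proof. by case/simplesE. Qed.

Lemma simple_compl a : simples S a -> simples S (right_compl S a).
Proof.
move=> sa; apply/simplesE; split; first exact: pos_compl.
rewrite /right_compl /prefix_le /pos_le.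
have -> : (a^-1 * d)^-1 * d = a ^ d by grp.
exact/posJ_delta/simple_pos.
Qed.

Lemma simple_mul a b : P a -> P b -> simples S (a * b) <-> le b (right_compl S a).
Proof.
move=> pa pb; rewrite simplesE /right_compl -(le_mul2l S a b) mulVKg.
by split=> [[]|?] //; split=> //; exact: posM.
Qed.

Lemma simple_mulr a b : P a -> P b -> simples S (a * b) -> simples S b.
Proof.
move=> pa pb sab; have sa := simple_mull pa pb sab.
by apply: (simple_prefix pb ((simple_mul pa pb).1 sab)); exact: simple_compl.
Qed.

Lemma pos_meet a b : P a -> P b -> P (meet a b).
Proof. by move=> /le1 ? /le1 ?; apply/le1/le_meet. Qed.

Lemma simple_meetr a : P a -> simples S (meet a d).
Proof.
by move=> pa; apply/simplesE; split; [apply: pos_meet => //; exact: pos_delta | exact: meet_ler].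
Qed.

Lemma meet_delta_conj a z : meet (a ^ D z) d = (meet a d) ^ D z.
Proof.
have dz : d ^ D z = d by rewrite -{1}(expgz1 d) conjgE -expgzD addrC expgzD mulKg expgz1.
have -> : meet (a ^ D z) d = meet (a ^ D z) (d ^ D z) by rewrite dz.
by rewrite !conjgE -meetMl -meetMD.
Qed.

(** Induction on a power of [delta] above [g]. The element [z] with [join g d = d * z] lies below
    [d ^+ n] and below [g ^ d], so it meets [d] trivially and is 1 by induction; hence [g] lies
    below [d]. *)
Lemma meet_delta_neq1 g : P g -> meet g d = 1 -> g = 1.
Proof.
have [n [gn _]] := le_bounded fin g.
elim: n g gn => [|n IH] g gn pg gd.
  by apply: (le_anti (S := S)) => //; apply/le1.
suff gd' : le g d by rewrite -gd meet_idl.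
pose z := d^-1 * join g d.
have pz : P z by exact: le_joinr.
have zn : le z (D (Posz n)).
  apply/(le_mul2l _ d); rewrite /z mulVKg; apply: join_le.
    by have <- : D (Posz n.+1) = d * D (Posz n) by rewrite /= expgS.
  by apply: le_mul; exact: pos_D.
have zg : le z (g ^ d).
  apply/(le_mul2l _ d); rewrite /z mulVKg -conjgC; apply: join_le.
    by apply: le_mul; exact: pos_delta.
  by rewrite conjgC; apply: le_mul; exact: posJ_delta.
have z1 : z = 1.
  apply: IH => //; apply: (le_anti (S := S)); last first.
    by apply/le1; apply: pos_meet => //; exact: pos_delta.
  have <- : meet (g ^ d) d = 1.
    by rewrite -(expgz1 d) meet_delta_conj // expgz1 gd conj1g.
  by apply: meet_mono => //; exact: le_refl.
have <- : join g d = d by rewrite -(mulVKg d (join g d)) -/z z1 mulg1.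
exact: le_joinl.
Qed.

Lemma atom_simple a : atoms S a -> simples S a.
Proof.
move=> aa; have sm := simple_meetr (atom_pos aa).
have [E|<-//] := le_atom aa (simple_pos sm) (meet_lel _ _ _).
by case: (aa) => pa a1 _; case: a1; exact: meet_delta_neq1.
Qed.

Lemma delta_neq1 a : atoms S a -> d <> 1.
Proof.
move=> aa E; case: (aa) => pa a1 _; apply: a1; apply: (le_anti (S := S)); last exact/le1.
by rewrite -E; apply/simple_le/atom_simple.
Qed.

Hypothesis sym : garside_symmetric S.

(** The factor [b] is a suffix of the simple element [a * b], so by symmetry a prefix:
    [a * b = b * a ^ b] with [a ^ b] positive of degree 1. All uses of symmetry go through this
    exchange and its mirror image below. *)
Lemma atom_conj_simple a b : atoms S a -> P b -> simples S (a * b) -> atoms S (a ^ b).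
Proof.
move=> aa pb sab; have pa := atom_pos aa; have sb := simple_mulr pa pb sab.
apply/atomsE; rewrite degreeJ atom_degree //; split=> //.
suff : prefix_le S b (a * b) by [].
by apply/sym => //; rewrite /suffix_ge mulgK.
Qed.

Lemma atom_conjV_simple a b : atoms S a -> P b -> simples S (b * a) -> atoms S (a ^ b^-1).
Proof.
move=> aa pb sba; have pa := atom_pos aa; have sb := simple_mull pb pa sba.
apply/atomsE; rewrite degreeJ atom_degree //; split=> //.
have : suffix_ge S (b * a) b by apply/sym => //; exact: le_mul.
by rewrite /suffix_ge conjgE invgK mulgA.
Qed.

End Degree.

(** * Left normal forms, their inverses, and finiteness of intervals *)

Section NormalForm.
Variables (G : groupType) (S : garside G).
Hypotheses (fin : finite_type S) (hom : homogeneous S) (delta1 : delta S <> 1).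
Implicit Types (a b c g h x y X : G) (z t p : int) (s : seq G).

Local Notation P := (pos S).
Local Notation d := (delta S).
Local Notation D := (expgz (delta S)).
Local Notation le := (prefix_le S).
Local Notation meet := (meet S).
Local Notation compl := (right_compl S).
Local Notation degree := (degree S).

Definition weighted : rel G := fun a b => `[< left_weighted S a b >].

Definition chain s : Prop :=
  (forall a, a \in s -> proper_simples S a) /\ sorted weighted s.

Lemma lnfE X p s :
  is_left_normal_form S X p s <-> X = D p * \prod_(a <- s) a /\ chain s.
Proof.
split=> [[E sP sW]|[E [sP /(sortedP 1) sW]]].
  by split=> //; split=> //; apply/(sortedP 1) => i si; apply/asboolP; exact: sW.
by split=> // i si; apply/asboolP; exact: sW.
Qed.

Lemma weightedE a b : weighted a b <-> meet (compl a) b = 1.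
Proof.
have E : meet (a * b) d = a * meet (compl a) b.
  by rewrite meetMl /right_compl mulVKg meetC.
rewrite /weighted; split=> [/asboolP|H]; last apply/asboolP; rewrite /left_weighted E.
  by move=> H; apply: (mulgI a); rewrite mulg1 -H.
by rewrite H mulg1.
Qed.

(** The nontrivial meet of [b] with the complement of [a] contains an atom; this is the atom that
    later arguments exchange or cancel. *)
Lemma not_weighted a b : simples S a -> P b -> ~ weighted a b ->
  exists e, [/\ atoms S e, le e b & simples S (a * e)].
Proof.
move=> sa pb /weightedE ab.
have pm : P (meet (compl a) b) by apply: pos_meet => //; exact: pos_compl.
have [e ae em] := atom_below hom pm ab; exists e; split=> //.
  by apply: le_trans em _; exact: meet_ler.
apply/simple_mul => //; [exact: simple_pos sa | exact: atom_pos | ].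
by apply: le_trans em _; exact: meet_lel.
Qed.

Lemma proper_simple a : proper_simples S a -> simples S a.
Proof. by case. Qed.

Lemma proper_neq1 a : proper_simples S a -> a <> 1.
Proof. by case=> _ H E; apply: H; left. Qed.

Lemma proper_neqd a : proper_simples S a -> a <> d.
Proof. by case=> _ H E; apply: H; right. Qed.

Lemma proper_pos a : proper_simples S a -> P a.
Proof. by move/proper_simple/simple_pos. Qed.

Lemma properI a : simples S a -> a <> 1 -> a <> d -> proper_simples S a.
Proof. by move=> sa a1 ad; split=> // -[]. Qed.

(** Since [a * d = d * a ^ d] lies above [d], the simple head of [a * g] depends on [g] only through
    the simple head of [g]. *)
Lemma meet_mul_delta a g : P a -> meet (a * g) d = meet (a * meet g d) d.
Proof.
move=> pa; rewrite meetMl -meetA; congr meet; rewrite meet_idr //.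
by rewrite conjgC; apply: le_mul; exact: posJ_delta.
Qed.

Lemma chain_pos s : chain s -> P (\prod_(a <- s) a).
Proof. by case=> sP _; apply: pos_prod => a /sP /proper_pos. Qed.

Lemma chain_cons a s : chain (a :: s) -> proper_simples S a /\ chain s.
Proof.
case=> sP /= sW; split; first by apply: sP; rewrite mem_head.
by split=> [b bs|]; [apply: sP; rewrite inE bs orbT | exact: path_sorted sW].
Qed.

Lemma chain_head a s : chain (a :: s) -> meet (\prod_(b <- a :: s) b) d = a.
Proof.
elim: s a => [|b s IH] a cs; have [pa cs'] := chain_cons cs.
  by rewrite big_seq1 meet_idl //; apply/simple_le/proper_simple.
rewrite big_cons meet_mul_delta; last exact: proper_pos.
by rewrite IH //; have [_ /= /andP[/asboolP]] := cs.
Qed.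

Lemma chain_not_delta s : chain s -> ~ le d (\prod_(a <- s) a).
Proof.
case: s => [_|a s cs dX].
  rewrite big_nil => d1; apply: delta1; apply: (le_anti (S := S)) => //.
  by apply/le1; exact: pos_delta.
have := chain_head cs; rewrite meet_idr // => E.
by have [/proper_neqd pa _] := chain_cons cs; apply: pa.
Qed.

Lemma lnf_inf_le X p s : is_left_normal_form S X p s -> le (D p) X.
Proof. by case/lnfE=> -> cs; apply: le_mul; exact: chain_pos. Qed.

Lemma lnf_inf_max X p s : is_left_normal_form S X p s -> ~ le (D (p + 1)%R) X.
Proof. by case/lnfE=> -> cs; rewrite expgzD expgz1 le_mul2l; exact: chain_not_delta. Qed.

Lemma delta_conj z : d ^ D z = d.
Proof. by rewrite -{1}(expgz1 d) conjgE -expgzD addrC expgzD mulKg expgz1. Qed.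

Lemma lnf_initial X p a s : is_left_normal_form S X p (a :: s) ->
  meet (X * D (- p)%R) d = a ^ D (- p)%R.
Proof.
case/lnfE=> -> cs; have dE : D p * d * D (- p)%R = d.
  by rewrite -[RHS](delta_conj (- p)%R) conjgE expgzN invgK mulgA.
by rewrite -[X in meet _ X]dE -meetMD // -meetMl chain_head // conjgE expgzN invgK mulgA.
Qed.

(** Greedy algorithm: split off [meet X d], which is nontrivial by [meet_delta_neq1], and recurse on
    the norm. *)
Lemma pos_lnf X : P X -> exists n s, is_left_normal_form S X (Posz n) s.
Proof.
move=> pX; have [m] := ubnP (norm S X); elim: m X pX => // m IH X pX Xm.
have [->|/eqP X1] := eqVneq X 1.
  by exists 0%N, [::]; apply/lnfE; rewrite big_nil expgz0 mulg1; split=> //; split.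
set a := meet X d; have sa : simples S a := simple_meetr pX.
have a1 : a <> 1 by move/(meet_delta_neq1 fin pX).
have pX' : P (a^-1 * X) by exact: meet_lel.
have XE : X = a * (a^-1 * X) by rewrite mulVKg.
have na := norm_gt0 (simple_pos sa) a1.
have [|n [s /lnfE[E cs]]] := IH _ pX'.
  by have := hom (simple_pos sa) pX'; rewrite mulVKg; lia.
have [ad|/eqP ad] := eqVneq a d.
  exists n.+1, s; apply/lnfE; split=> //.
  by rewrite XE E {1}ad mulgA /= expgS.
have aE : a = meet (a * meet (a^-1 * X) d) d.
  by rewrite -meet_mul_delta ?mulVKg //; exact: simple_pos.
(* If the remainder still had the prefix [d], then [a * d = d * a ^ d] would put [d] below [X] and
   make [a] equal to [d]. *)
have n0 : n = 0%N.
  case: n E => // n E; case: ad; rewrite aE meet_idr // {1}(_ : meet _ _ = d).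
    by rewrite conjgC; apply: le_mul; apply/posJ_delta/simple_pos.
  rewrite meet_idr // E /= expgS -mulgA; apply: le_mul.
  by apply: posM; [exact: pos_D | exact: chain_pos].
rewrite {n}n0 expgz0 mul1g in E.
exists 0%N, (a :: s); apply/lnfE; rewrite expgz0 mul1g big_cons -E mulVKg; split=> //.
have [sP sW] := cs; split=> [b|].
  by rewrite inE => /orP[/eqP->|/sP//]; exact: properI.
case: s E cs {sP} sW => // b s E cs sW; rewrite /= in sW *; rewrite sW andbT; apply/asboolP.
by rewrite /left_weighted -{1}(chain_head cs) -E -aE.
Qed.

Lemma lnf_exists X : exists p s, is_left_normal_form S X p s.
Proof.
have [n [_ nX]] := le_bounded fin X.
have [m [s /lnfE[E cs]]] := pos_lnf nX.
exists (m%:Z - n%:Z)%R, s; apply/lnfE; split=> //.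
by rewrite addrC expgzD -mulgA -E mulVKg.
Qed.

Lemma left_normal_formP X :
  is_left_normal_form S X (lnf_inf S X) (left_normal_form S X).2.
Proof.
have [p [s Xps]] := lnf_exists X.
exact: (@xgetPex _ (Posz 0, [::]) [set ps | is_left_normal_form S X ps.1 ps.2]
  (ex_intro _ (p, s) Xps)).
Qed.

(** The normal form of the inverse: since [a^-1 = compl a * d^-1], collecting the powers of [delta]
    on the left reverses the factors and turns the [i]-th one into its complement conjugated by the
    power [-(p + i)] of [delta]. *)
Fixpoint inverse_chain p s : seq G :=
  if s is a :: s' then rcons (inverse_chain (p + 1)%R s') (compl a ^ D (- (p + 1))%R)
  else [::].

Lemma size_inverse_chain p s : size (inverse_chain p s) = size s.
Proof. by elim: s p => //= a s IH p; rewrite size_rcons IH. Qed.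

Lemma prod_inverse_chain p s :
  (D p * \prod_(a <- s) a)^-1 =
  D (- (p + (size s)%:Z))%R * \prod_(a <- inverse_chain p s) a.
Proof.
elim: s p => [|a s IH] p; first by rewrite /= !big_nil !mulg1 -expgzN addr0.
rewrite /= big_cons -cats1 big_cat big_seq1 /=.
have -> : D (- (p + (size s).+1%:Z))%R = D (- (p + 1 + (size s)%:Z))%R.
  by congr (D _); lia.
rewrite [RHS]mulgA -IH [D (p + 1)%R]expgzD expgz1 conjgE /right_compl expgzN expgzD expgz1.
by grp.
Qed.

Lemma compl_conj a z : compl (a ^ D z) = compl a ^ D z.
Proof.
by rewrite /right_compl conjMg delta_conj conjVg.
Qed.

Lemma compl_compl a : compl (compl a) = a ^ d.
Proof. by rewrite /right_compl; grp. Qed.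

Lemma simple_conj a z : simples S a -> simples S (a ^ D z).
Proof.
case/simplesE=> pa ad; apply/simplesE; split; first exact: pos_conj.
by have := pos_conj fin z ad; rewrite conjMg conjVg delta_conj.
Qed.

Lemma proper_conj a z : proper_simples S a -> proper_simples S (a ^ D z).
Proof.
move=> pa; have dE := delta_conj z.
apply: properI.
- exact/simple_conj/proper_simple.
- by move=> E; apply: (proper_neq1 pa); apply: (conjg_inj (D z)); rewrite conj1g.
- by move=> E; apply: (proper_neqd pa); apply: (conjg_inj (D z)); rewrite dE.
Qed.

Lemma proper_compl a : proper_simples S a -> proper_simples S (compl a).
Proof.
move=> pa; apply: properI; first exact/simple_compl/proper_simple.
  by move=> E; apply: (proper_neqd pa); rewrite -(mulVKg a d) -/(compl a) E mulg1.
move=> E; apply: (proper_neq1 pa); apply: invg_inj; apply: (mulIg d).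
by rewrite invg1 mul1g.
Qed.

Lemma inverse_chainP p s : chain s -> chain (inverse_chain p s).
Proof.
elim: s p => [|a s IH] p cs //; have [pa cs'] := chain_cons cs.
have [IH1 IH2] := IH (p + 1)%R cs'; split=> [b|].
  rewrite mem_rcons inE => /orP[/eqP->|/IH1//].
  exact/proper_conj/proper_compl.
case: s cs {cs' IH IH1} IH2 => // b s cs IH2.
have srt (r : seq G) u v : sorted weighted (rcons r u) -> weighted u v ->
    sorted weighted (rcons (rcons r u) v).
  case: r => [|w r] /=; first by rewrite andbT.
  by move=> H uv; rewrite (rcons_path _ _ (rcons r u)) H last_rcons.
apply: srt => //; apply/weightedE; rewrite compl_conj compl_compl -(expgz1 d).
rewrite -conjgM -expgzD; have -> : (1 + - (p + 1 + 1) = - (p + 1))%R by lia.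
have := cs.2; rewrite /= => /andP[/weightedE ab _].
by rewrite !conjgE -meetMl -meetMD // meetC ab mul1g mulVg.
Qed.

Lemma lnf_inverse X p s : is_left_normal_form S X p s ->
  is_left_normal_form S X^-1 (- (p + (size s)%:Z))%R (inverse_chain p s).
Proof.
case/lnfE=> -> cs; apply/lnfE; split; last exact: inverse_chainP.
exact: prod_inverse_chain.
Qed.

Lemma inverse_chain_rcons p s a : inverse_chain p (rcons s a) =
  (compl a ^ D (- (p + (size s).+1%:Z))%R) :: behead (inverse_chain p (rcons s a)).
Proof. by elim: s p => [|b s IH] p //=; rewrite IH /=; congr (_ ^ D _ :: _); lia. Qed.

(** The last factor of [X] is read off from the first factor of [X^-1], which lets decycling be
    treated as a cycling of the inverse. *)
Lemma lnf_final X p s a : is_left_normal_form S X p (rcons s a) ->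
  meet (X^-1 * D (p + (size s).+1%:Z)%R) d = compl a.
Proof.
move/lnf_inverse; rewrite inverse_chain_rcons size_rcons => /lnf_initial.
by rewrite opprK -conjgM -expgzD addNr expgz0 conjg1.
Qed.

Lemma chain_rcons s a : chain (rcons s a) ->
  [/\ chain s, proper_simples S a & (0 < size s)%N -> weighted (last 1 s) a].
Proof.
case=> sP sW; split.
- split; first by move=> b bs; apply: sP; rewrite mem_rcons inE bs orbT.
  by case: s {sP} sW => //= b s; rewrite rcons_path => /andP[].
- by apply: sP; rewrite mem_rcons mem_head.
- by case: s {sP} sW => //= b s; rewrite rcons_path => /andP[].
Qed.

Lemma prod_simples_le s : (forall a, a \in s -> simples S a) ->
  le (\prod_(a <- s) a) (D (Posz (size s))).
Proof.
elim: s => [|a s IH] sP; first by rewrite big_nil; exact: le_refl.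
rewrite big_cons; apply: (@le_trans _ _ (a * D (Posz (size s)))).
  by apply/le_mul2l/IH => b bs; apply: sP; rewrite inE bs orbT.
rewrite /= expgS; apply/(le_mulD fin _ _ (Posz (size s)))/simple_le/sP.
exact: mem_head.
Qed.

Lemma le_inv a z : le a^-1 (D z) <-> le (D (- z)%R) a.
Proof.
rewrite -(le_mul2l _ a) mulgV -(le_mulD fin _ _ (- z)%R) mul1g -mulgA -expgzD.
by rewrite subrr expgz0 mulg1.
Qed.

Lemma lnf_sup_le X p s : is_left_normal_form S X p s -> le X (D (p + (size s)%:Z)%R).
Proof. by move=> /lnf_inverse /lnf_inf_le; rewrite -le_inv invgK. Qed.

Lemma lnf_sup_min X p s : is_left_normal_form S X p s ->
  ~ le X (D (p + (size s)%:Z - 1)%R).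
Proof.
move=> /lnf_inverse /lnf_inf_max H; rewrite -[X]invgK le_inv.
by have <- : (- (p + (size s)%:Z) + 1 = - (p + (size s)%:Z - 1))%R by lia.
Qed.

Lemma lnf_unique X p s p' s' : is_left_normal_form S X p s ->
  is_left_normal_form S X p' s' -> p = p' /\ size s = size s'.
Proof.
have aux u v w r : is_left_normal_form S X u w -> is_left_normal_form S X v r ->
    (u <= v)%R /\ (v + (size r)%:Z <= u + (size w)%:Z)%R.
  move=> H1 H2; split; apply: contrapT => uv.
    by apply: (lnf_inf_max H2); apply: le_trans (lnf_inf_le H1); apply: le_D2 => //; lia.
  by apply: (lnf_sup_min H2); apply: le_trans (lnf_sup_le H1) _; apply: le_D2 => //; lia.
by move=> H1 H2; have [? ?] := aux _ _ _ _ H1 H2; have [? ?] := aux _ _ _ _ H2 H1; lia.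
Qed.

Lemma simple_seq_prod n : exists r : seq G, forall s,
  (forall a, a \in s -> simples S a) -> (size s <= n)%N -> \prod_(a <- s) a \in r.
Proof.
have [t tE] := (finite_seqP _).1 fin.
have tP a : simples S a -> a \in t by rewrite tE.
elim: n => [|n [r rP]].
  by exists [:: 1] => -[|//] _ _; rewrite big_nil mem_head.
exists (r ++ [seq a * b | a <- t, b <- r]) => -[|a s] sP sn; rewrite mem_cat.
  by rewrite rP.
rewrite big_cons; apply/orP; right; apply/allpairsP; exists (a, \prod_(b <- s) b); split=> //.
  by apply/tP/sP; rewrite mem_head.
by apply: rP => // b bs; apply: sP; rewrite inE bs orbT.
Qed.

(** Such an [X] is [D z] times a bounded number of simple elements. This serves the pigeonhole
    arguments on orbits of sliding, cycling and decycling. *)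
Lemma interval_finite z t : exists r : seq G, forall X,
  le (D z) X -> le X (D t) -> X \in r.
Proof.
have [r rP] := simple_seq_prod `|t - z|%N.
exists [seq D z * b | b <- r] => X zX Xt.
have [n [s lX]] := pos_lnf zX; have [E cs] := (lnfE _ _ _).1 lX.
apply/mapP; exists (D (- z)%R * X); last by rewrite expgzN mulVKg.
have ns : (n + size s <= `|t - z|)%N.
  have [//|nt] := leqP; exfalso; apply: (lnf_sup_min lX).
  rewrite -(le_mul2l _ (D z)) mulVKg -expgzD; apply: le_trans Xt _; apply: le_D2 => //; lia.
have : \prod_(b <- nseq n d ++ s) b \in r.
  apply: rP; last by rewrite size_cat size_nseq.
  move=> a; rewrite mem_cat => /orP[/nseqP[-> _]|as_]; last first.
    by case: cs => /(_ _ as_) /proper_simple.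
  by apply/simplesE; split; [exact: pos_delta | exact: le_refl].
by rewrite big_cat /= big_nseq iter_mulg_1 expgzN E.
Qed.

End NormalForm.

(** * Cycling, decycling and sliding as monotone maps of positions *)

Section Positions.
Variables (G : groupType) (S : garside G).
Hypotheses (fin : finite_type S) (hom : homogeneous S) (delta1 : delta S <> 1).
Implicit Types (a b c g h x y X Y : G) (z t p q r : int).

Local Notation P := (pos S).
Local Notation d := (delta S).
Local Notation D := (expgz (delta S)).
Local Notation le := (prefix_le S).
Local Notation meet := (meet S).
Local Notation compl := (right_compl S).
Local Notation degree := (degree S).

Lemma infE X p : le (D p) X <-> (p <= lnf_inf S X)%R.
Proof.
have H := left_normal_formP fin hom X; split=> pX; last first.
  by apply: le_trans (lnf_inf_le H); exact: le_D2.
apply: contrapT => np; apply: (lnf_inf_max delta1 H); apply: le_trans pX.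
by apply: le_D2 => //; lia.
Qed.

Lemma supE X q : le X (D q) <-> (lnf_inf S X + (ell S X)%:Z <= q)%R.
Proof.
have H := left_normal_formP fin hom X; split=> Xq; last first.
  by apply: le_trans (lnf_sup_le fin H) _; exact: le_D2.
apply: contrapT => np; apply: (lnf_sup_min fin delta1 H); apply: le_trans Xq _.
by apply: le_D2 => //; rewrite -/(ell S X); lia.
Qed.

(** The value 1 in length 0 makes [kap] agree with the trivial cycling of a power of [delta]. *)
Lemma iota_meet X : meet (X * D (- lnf_inf S X)%R) d =
  if (0 < ell S X)%N then initial_factor S X else 1.
Proof.
have := left_normal_formP fin hom X; rewrite /ell /initial_factor.
move: (lnf_inf S X) => p; case: (left_normal_form S X).2 => [|a s] H.
  2: exact: (lnf_initial fin H).
have [-> _] := (lnfE _ _ _ _).1 H.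
rewrite big_nil mulg1 -expgzD subrr expgz0 /= meet_idl //.
by apply/le1; exact: pos_delta.
Qed.

Lemma final_meet X : meet (X^-1 * D (lnf_inf S X + (ell S X)%:Z)%R) d =
  if (0 < ell S X)%N then compl (final_factor S X) else 1.
Proof.
have := left_normal_formP fin hom X; rewrite /ell /final_factor.
move: (lnf_inf S X) => p; case: (left_normal_form S X).2 => [|a s] H.
  have [-> _] := (lnfE _ _ _ _).1 H.
  rewrite big_nil mulg1 addr0 mulVg /= meet_idl //.
  by apply/le1; exact: pos_delta.
by move: H; rewrite lastI size_rcons last_rcons => /(lnf_final fin) ->.
Qed.

(* For [p] and [q] the infimum and supremum of [Y ^ g], these are the positions
   of the cycling, the decycling and the cyclic sliding of [Y ^ g]. *)
Definition kap Y p g := meet (Y * g * D (- p)%R) (g * d).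
Definition dec Y q g := kap Y^-1 (- q)%R g * D (- 1)%R.
Definition sig Y p q g := meet (kap Y p g) (kap Y^-1 (- q)%R g).

(* An upper bound [q] on the supremum of [Y ^ g] is [infge Y^-1 (- q) g]. *)
Definition infge Y p g : Prop := le (g * D p) (Y * g).

Lemma conj_le Y p g : infge Y p g <-> le (D p) (Y ^ g).
Proof. by rewrite /infge -(le_mul2l S g (D p)) conjgE mulVKg. Qed.

Lemma infgeE Y p g : infge Y p g <-> (p <= lnf_inf S (Y ^ g))%R.
Proof. by rewrite conj_le infE. Qed.

Lemma supleE Y q g :
  infge Y^-1 (- q)%R g <-> (lnf_inf S (Y ^ g) + (ell S (Y ^ g))%:Z <= q)%R.
Proof. by rewrite conj_le conjVg -le_inv // invgK supE. Qed.

Lemma infgeM Y p g : infge Y p g -> infge Y p (Y * g).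
Proof. by rewrite /infge -[Y * g * _]mulgA le_mul2l. Qed.

Lemma infgeV Y p g : infge Y p g -> infge Y p (Y^-1 * g).
Proof.
by rewrite /infge -[Y^-1 * g * _]mulgA => H; apply/(le_mul2l _ Y); rewrite !mulVKg.
Qed.

Lemma infgeD Y p g z : infge Y p (g * D z) <-> infge Y p g.
Proof.
rewrite /infge -mulgA -expgzD addrC expgzD !mulgA.
by rewrite (le_mulD fin).
Qed.

Lemma infge_delta Y p g : infge Y p (g * d) <-> infge Y p g.
Proof. by rewrite -{1}(expgz1 d) infgeD. Qed.

(** Left multiplication by [Y] and right multiplication by powers of [delta] distribute over meets.
    Thus every operation entering [kap], [dec] and [sig] preserves bounds on inf and sup. *)
Lemma infge_meet Y p g h : infge Y p g -> infge Y p h -> infge Y p (meet g h).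
Proof. by rewrite /infge meetMD // meetMl => ? ?; exact: meet_mono. Qed.

Lemma infge_mono Y p q g : (p <= q)%R -> infge Y q g -> infge Y p g.
Proof. by move=> pq; rewrite !infgeE; lia. Qed.

Lemma infge_kap Y p z g : infge Y p g -> infge Y p (kap Y z g).
Proof.
move=> H; apply: infge_meet; last exact/infge_delta.
by apply/infgeD; exact: infgeM.
Qed.

Lemma infge_kapV Y p z g : infge Y p g -> infge Y p (kap Y^-1 z g).
Proof.
move=> H; apply: infge_meet; last exact/infge_delta.
by apply/infgeD; exact: infgeV.
Qed.

Lemma infge_kapV' Y p z g : infge Y^-1 p g -> infge Y^-1 p (kap Y z g).
Proof. by move/(infge_kapV z); rewrite invgK. Qed.

Lemma infge_dec Y p q g : infge Y p g -> infge Y p (dec Y q g).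
Proof. by move=> H; apply/infgeD; exact: infge_kapV. Qed.

Lemma infge_decV Y p q g : infge Y^-1 p g -> infge Y^-1 p (dec Y q g).
Proof. by move=> H; apply/infgeD; exact: infge_kap. Qed.

Lemma infge_sig Y p q z g : infge Y p g -> infge Y p (sig Y z q g).
Proof. by move=> H; apply: infge_meet; [exact: infge_kap | exact: infge_kapV]. Qed.

Lemma infge_sigV Y p q z g : infge Y^-1 p g -> infge Y^-1 p (sig Y z q g).
Proof. by move=> H; apply: infge_meet; [exact: infge_kapV' | exact: infge_kap]. Qed.

Lemma kapE Y p g : kap Y p g = g * meet (Y ^ g * D (- p)%R) d.
Proof. by rewrite /kap meetMl conjgE !mulgA mulgV mul1g. Qed.

Lemma kap_mono Y p g h : le g h -> le (kap Y p g) (kap Y p h).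
Proof.
move=> gh; apply: meet_mono; first by apply/le_mulD => //; apply/le_mul2l.
by rewrite -(expgz1 d); apply/le_mulD.
Qed.

Lemma delta_D z : D z * d = d * D z.
Proof. by rewrite -(expgz1 d) -!expgzD addrC. Qed.

Lemma delta_DN1 : d * D (- 1)%R = 1.
Proof. by rewrite -{1}(expgz1 d) -expgzD subrr. Qed.

Lemma kapD Y p g z : kap Y p (g * D z) = kap Y p g * D z.
Proof.
by rewrite /kap meetMD // -!mulgA -delta_D -!expgzD [(z - p)%R]addrC.
Qed.

Lemma kap_meet Y p g h : kap Y p (meet g h) = meet (kap Y p g) (kap Y p h).
Proof.
have H := meetMD fin g h 1%R; rewrite expgz1 in H; rewrite /kap meetMl meetMD // H.
apply: (le_ext (S := S)) => e; rewrite !le_meet; tauto.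
Qed.

Lemma le_kap Y p g : infge Y p g -> le g (kap Y p g).
Proof.
move=> H; apply/le_meet; split; last by apply: le_mul; exact: pos_delta.
by rewrite -(le_mulD fin _ _ p) expgzN mulgVK.
Qed.

Lemma kap_le Y p g : le (kap Y p g) (g * d).
Proof. exact: meet_ler. Qed.

(** Detects a parameter [p] strictly below the infimum: exactly then a step of [kap] is a full
    multiplication by [delta]. *)
Lemma kap_full Y p g : infge Y (p + 1)%R g <-> kap Y p g = g * d.
Proof.
have E : le (g * d) (Y * g * D (- p)%R) <-> infge Y (p + 1)%R g.
  by rewrite /infge -(le_mulD fin (g * d) _ p) expgzN mulgVK -mulgA -delta_D expgzD expgz1.
split=> [/E H|H]; first by rewrite /kap meet_idr.
by apply/E; rewrite -H; exact: meet_lel.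
Qed.

(** The expanded composite is symmetric under exchanging [Y], [p] with [Y^-1], [r]; this yields
    commutation in [kapC]. *)
Lemma kap_kap Y p r g : kap Y p (kap Y^-1 r g) =
  meet (meet (g * D (- (p + r))%R) (g * D 2%R))
       (meet (Y * g * D (1 - p)%R) (Y^-1 * g * D (1 - r)%R)).
Proof.
have d2 : D 2%R = d * d by rewrite -{2 3}(expgz1 d) -expgzD.
rewrite {2}/kap kap_meet /kap -!mulgA mulVKg -!delta_D -!expgzD -d2.
rewrite !(expgzD _ 1) expgz1 -!delta_D opprD [(- r - p)%R]addrC.
apply: (le_ext (S := S)) => e; rewrite !le_meet; tauto.
Qed.

Lemma kapC Y p r g : kap Y p (kap Y^-1 r g) = kap Y^-1 r (kap Y p g).
Proof.
have := kap_kap Y^-1 r p g; rewrite invgK => ->; rewrite kap_kap [(r + p)%R]addrC.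
apply: (le_ext (S := S)) => e; rewrite !le_meet; tauto.
Qed.

Lemma kap_decC Y p q g : kap Y p (dec Y q g) = dec Y q (kap Y p g).
Proof. by rewrite /dec kapD kapC. Qed.

(** In [kap_kap] the term [g * D (q - p)] is absorbed by [g * D 2] because [q - p] is at least 2;
    shifted by [delta^-1], the remaining terms are those of [sig]. *)
Lemma kap_dec Y p q g : (p + 2 <= q)%R -> kap Y p (dec Y q g) = sig Y p q g.
Proof.
move=> pq; rewrite /dec kapD kap_kap.
have -> : (- (p - q) = q - p)%R by lia.
rewrite [meet (g * D (q - p)%R) _]meet_idr; last by apply: le_mulD2 => //; lia.
rewrite /sig /kap !meetMD // -!mulgA -!expgzD.
have -> : (1 - p + -1 = - p)%R by lia.
have -> : (1 - - q + -1 = - - q)%R by lia.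
rewrite delta_DN1 mulg1; apply: (le_ext (S := S)) => e; rewrite !le_meet; tauto.
Qed.

Lemma dec_mono Y q g h : le g h -> le (dec Y q g) (dec Y q h).
Proof. by move=> gh; apply/le_mulD => //; exact: kap_mono. Qed.

Lemma decD Y q g z : dec Y q (g * D z) = dec Y q g * D z.
Proof. by rewrite /dec kapD -!mulgA -!expgzD addrC. Qed.

Lemma dec_le Y q g : le (dec Y q g) g.
Proof.
have := (le_mulD fin _ _ (- 1)%R).2 (kap_le Y^-1 (- q)%R g).
by rewrite -[g * d * _]mulgA delta_DN1 mulg1.
Qed.

Lemma le_dec Y q g : infge Y^-1 (- q)%R g -> le g (dec Y q g * d).
Proof. by rewrite /dec -mulgA delta_D delta_DN1 mulg1; exact: le_kap. Qed.

Section Exact.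
Variables (Y g : G).
Local Notation p := (lnf_inf S (Y ^ g)).
Local Notation q := (lnf_inf S (Y ^ g) + (ell S (Y ^ g))%:Z)%R.

Lemma cyclingE : cycling S (Y ^ g) = Y ^ kap Y p g.
Proof.
rewrite /cycling kapE iota_meet conjgM; case: ifP => // _.
by rewrite conjg1.
Qed.

Lemma kap_final : kap Y^-1 (- q)%R g =
  g * (if (0 < ell S (Y ^ g))%N then compl (final_factor S (Y ^ g)) else 1).
Proof. by rewrite kapE opprK conjVg final_meet. Qed.

Lemma ell0 : ell S (Y ^ g) = 0%N -> exists z, Y ^ g = D z.
Proof.
have := left_normal_formP fin hom (Y ^ g); rewrite /ell => H /size0nil E.
rewrite E in H; have [XE _] := (lnfE _ _ _ _).1 H.
by exists p; rewrite [LHS]XE big_nil mulg1.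
Qed.

Lemma decyclingE : decycling S (Y ^ g) = Y ^ dec Y q g.
Proof.
rewrite /decycling /dec kap_final; case: ifP => [_|/negbT].
  by rewrite /right_compl mulgA -[_ * d * _]mulgA delta_DN1 mulg1 conjgM.
(* In length 0 [dec] still moves by [delta^-1], but this commutes with the power of [delta] that
   [Y ^ g] is. *)
rewrite -eqn0Ngt => /eqP /ell0[z E]; rewrite mulg1 conjgM.
by rewrite E conjgE -expgzD addrC expgzD mulKg.
Qed.

Lemma slidingE : sliding S (Y ^ g) = Y ^ sig Y p q g.
Proof.
rewrite /sliding /sig kap_final kapE iota_meet /preferred_prefix -meetMl.
case: ifP => _; first by rewrite conjgM.
by rewrite meet_idl ?mulg1 //; exact: le_refl.
Qed.

End Exact.

End Positions.

(** * Normal form of a conjugated atom power times an atom power *)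

Section ProductForm.
Variables (G : groupType) (S : garside G).
Hypotheses (fin : finite_type S) (hom : homogeneous S) (sym : garside_symmetric S).
Implicit Types (a b c e g h u v x y X Y Q U V : G) (z t p q r : int) (k l n m i j : nat).

Local Notation P := (pos S).
Local Notation d := (delta S).
Local Notation D := (expgz (delta S)).
Local Notation le := (prefix_le S).
Local Notation meet := (meet S).
Local Notation compl := (right_compl S).

Lemma meet_mul_compl a b : meet (a * b) d = a * meet (compl a) b.
Proof. by rewrite meetMl /right_compl mulVKg meetC. Qed.

Lemma commuteJ x n V : (x ^+ n) ^ (x * V) = (x ^+ n) ^ V.
Proof.
rewrite conjgM; congr (_ ^ _); rewrite conjgE -expgSr expgS mulKg //.
Qed.

Lemma atom_neq1 x : atoms S x -> x <> 1. Proof. by case. Qed.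

Lemma not_simple_sq x : square_free S -> atoms S x -> ~ simples S (x * x).
Proof.
move=> sqf ax; have := sqf 1 1 x (pos1 S) (pos1 S) ax.
by rewrite mul1g mulg1 expg2.
Qed.

(** By induction it remains to see that one more [y] on the left leaves the head [y * b] unchanged,
    that is, that [e] equals [b]. *)
Lemma meet_power y n a : atoms S y -> simples S a ->
  ((2 <= n)%N -> square_free S) -> (0 < n)%N ->
  meet (y ^+ n * a) d = y * meet (compl y) a.
Proof.
move=> ay sa; have py := atom_pos ay.
elim: n => // -[|n] IH sqf _; first by rewrite expg1 meet_mul_compl.
have {}IH := IH (fun _ => sqf isT) isT.
have pa := simple_pos sa.
have sy := atom_simple fin ay.
have pX : P (y ^+ n.+1) by elim: (n.+1) => [|m Hm]; [exact: pos1 | rewrite expgS; exact: posM].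
rewrite expgS -mulgA meet_mul_delta // IH meet_mul_compl; congr (_ * _).
set b := meet (compl y) a.
have pb : P b by apply: pos_meet => //; exact: pos_compl.
have bc : le b (compl y) by exact: meet_lel.
have syb : simples S (y * b) by apply/simple_mul.
set e := meet (compl y) (y * b).
have pe : P e by apply: pos_meet; [exact: pos_compl | exact: posM].
have ec : le e (compl y) by exact: meet_lel.
have sye : simples S (y * e) by apply/simple_mul.
(* Otherwise [y * y] would be a prefix of the simple element [y * e]. *)
have ye : ~ le y e.
  move=> H; apply: (not_simple_sq (sqf isT) ay).
  have -> : y * y = (y * y) * 1 by rewrite mulg1.
  apply: (simple_prefix _ _ sye); first by rewrite mulg1; exact: posM.
  by rewrite mulg1; apply/le_mul2l.
have ae := atom_conj_simple fin hom sym ay pe sye.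
have ab := atom_conj_simple fin hom sym ay pb syb.
apply: (le_anti (S := S)); last first.
  apply/le_meet; split=> //.
  by rewrite conjgC; apply: le_mul; exact: atom_pos ab.
(* The join lies between [e] and [y * e = e * y ^ e], which differ by an atom, and it is not [e]. As
   [y] and [e] are prefixes of [y * b], this gives [e] below [b]. *)
have jE : join S y e = y * e.
  have [||E//|E] := @le_mul_atom _ _ e (join S y e) _ ae.
  - exact: le_joinr.
  - rewrite -conjgC; apply: join_le; first exact: le_mul.
    by rewrite conjgC; apply: le_mul; exact: atom_pos ae.
  - by case: ye; rewrite -E; exact: le_joinl.
  - by rewrite E -conjgC.
apply/(le_mul2l _ y); rewrite -jE; apply: join_le; first exact: le_mul.
exact: meet_ler.
Qed.

Lemma path_nseq (T : Type) (e : rel T) (u x : T) n :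
  ((0 < n)%N -> e u x) -> ((1 < n)%N -> e x x) -> path e u (nseq n x).
Proof.
elim: n u => //= n IH u ux xx; rewrite ux //=.
by apply: IH => n0; apply: xx; lia.
Qed.

Lemma last_nseq (T : Type) (x : T) n : last x (nseq n x) = x.
Proof. by elim: n. Qed.

Lemma weighted_sq x : square_free S -> atoms S x -> weighted S x x.
Proof.
move=> sqf ax; apply: contrapT => H.
have [e [ae ex sxe]] := not_weighted hom (atom_simple fin ax) (atom_pos ax) H.
have [E|E] := le_atom ax (atom_pos ae) ex; first by case: (atom_neq1 ae).
by apply: (not_simple_sq sqf ax); rewrite -{2}E.
Qed.

(* No cancellation and no exchange of the form [x e = e x'] occurs on the left
   of [V] in the conjugate [(x ^+ k) ^ V]. *)
Definition reduced x V : Prop :=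
  ~ le x V /\ forall e, atoms S e -> le e V -> ~ simples S (x * e).

Lemma reducedW x U V : le U V -> reduced x V -> reduced x U.
Proof.
move=> UV [H1 H2]; split; first by move=> /le_trans /(_ UV).
by move=> e ae eU; apply: H2 => //; exact: le_trans UV.
Qed.

(** Each failure of reducedness shortens [U]: a prefix [x] cancels because it commutes with
    [x ^+ k], and an exchange replaces [x] by the atom [x ^ e]. Removing a positive prefix keeps the
    bound by [D n]. *)
Lemma reduced_exists x0 k n U : atoms S x0 -> P U -> le U (D (Posz n)) ->
  exists x V, [/\ (conj_class x0 `&` atoms S) x, P V, le V (D (Posz n)),
                  (x0 ^+ k) ^ U = (x ^+ k) ^ V & reduced x V].
Proof.
move=> ax0; have cx0 : conj_class x0 x0 by exists 1 => //; rewrite conjg1.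
have [m] := ubnP (norm S U); elim: m U x0 ax0 cx0 => // m IH U x ax cx Um pU Un.
have step a U' : U = a * U' -> P a -> a <> 1 -> P U' ->
    (norm S U' < m)%N /\ le U' (D (Posz n)).
  move=> E pa a1 pU'; split.
    by have := norm_gt0 pa a1; move: Um; rewrite E hom //; lia.
  apply/(le_mul2l _ a); rewrite -E; apply: le_trans Un _.
  by rewrite conjgC; apply: le_mul; exact: pos_conj.
have [xU|xU] := pselect (le x U).
  have E : U = x * (x^-1 * U) by rewrite mulVKg.
  have [] := step _ _ E (atom_pos ax) (atom_neq1 ax) xU.
  move=> h1 h2; have [x1 [V [? ? ? ? ?]]] := IH _ _ ax cx h1 xU h2.
  by exists x1, V; split=> //; rewrite E commuteJ.
have [[e [ae eU sxe]]|H] := pselect (exists e, [/\ atoms S e, le e U & simples S (x * e)]).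
  have E : U = e * (e^-1 * U) by rewrite mulVKg.
  have [] := step _ _ E (atom_pos ae) (atom_neq1 ae) eU.
  have ax1 := atom_conj_simple fin hom sym ax (atom_pos ae) sxe.
  have cx1 : conj_class (x ^ e) (x ^ e) by exists 1 => //; rewrite conjg1.
  move=> h1 h2; have [x1 [V [[[w _ <-] ?] ? ? H ?]]] := IH _ _ ax1 cx1 h1 eU h2.
  exists ((x ^ e) ^ w), V; split=> //.
    by split=> //; exists (e * w) => //; rewrite conjgM.
  by rewrite {1}E conjgM conjXg.
exists x, U; split=> //; split=> // e ae eU sxe; apply: H; by exists e.
Qed.

(** The exponent of [delta] in [V] is 0, since [x] lies below [delta] but not below [V]. *)
Lemma reduced_chain x V : atoms S x -> P V -> reduced x V ->
  exists2 b : seq G, chain S b & V = \prod_(a <- b) a.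
Proof.
move=> ax pV [xV _]; have [n [b /lnfE[E cb]]] := pos_lnf fin hom pV.
exists b => //; case: n E => [|n] E; first by rewrite E expgz0 mul1g.
case: xV; apply: le_trans (simple_le (atom_simple fin ax)) _.
rewrite E /= expgS -mulgA; apply: le_mul; apply: posM; first exact: pos_D.
exact: chain_pos.
Qed.

Section Chain.
Variables (x y : G) (k j : nat) (b : seq G).
Hypotheses (ax : atoms S x) (ay : (0 < j)%N -> atoms S y).
Hypotheses (k0 : (0 < k)%N) (b0 : (0 < size b)%N).
Hypothesis sqfk : (2 <= k)%N -> square_free S.
Hypothesis sqfj : (2 <= j)%N -> square_free S.
Hypothesis cb : chain S b.
Hypothesis rb : reduced x (\prod_(a <- b) a).
Hypothesis wb : (0 < j)%N -> weighted S (last 1 b) y.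

Lemma product_chain : chain S (inverse_chain S 0 b ++ nseq k x ++ b ++ nseq j y).
Proof.
case: b b0 cb rb wb => // b1 b' _ cb' rb' wb'.
have [pb1 _] := chain_cons cb'; have [bP /= bW] := cb'.
have le1 : le b1 (\prod_(a <- b1 :: b') a).
  rewrite big_cons; apply: le_mul; exact: chain_pos (chain_cons cb').2.
have [xb1 exch] := reducedW le1 rb'.
(* If [x] were [d], the proper simple [b1] would lie below an atom different from it. *)
have px : proper_simples S x.
  apply: properI; [exact: atom_simple | exact: atom_neq1 |] => xd.
  have ad : atoms S d by rewrite -xd.
  have [E|E] := le_atom ad (proper_pos pb1) (simple_le (proper_simple pb1)).
    exact: (proper_neq1 pb1).
  exact: (proper_neqd pb1).
have py : (0 < j)%N -> proper_simples S y.
  move=> j0; apply: properI; [exact: atom_simple (ay j0) | exact: atom_neq1 (ay j0) |] => yd.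
  have pl : proper_simples S (last 1 (b1 :: b')) by apply: bP; rewrite /= mem_last.
  have sc := simple_compl (proper_simple pl).
  have /weightedE := wb' j0; rewrite yd (meet_idl (simple_le sc)) => E.
  have lE : last 1 (b1 :: b') = d by rewrite -(mulVKg (last 1 (b1 :: b')) d) -/(compl _) E mulg1.
  exact: proper_neqd pl lE.
have [iP iW] := inverse_chainP fin 0%R cb'.
split=> [c|].
  rewrite -?cat_cons !mem_cat => /or4P[ci|/nseqP[-> _] //|cb''|/nseqP[-> j0]].
  - exact: iP.
  - exact: bP.
  - exact: py.
(* The complement of this factor is [b1], and the atom [x] is not below [b1]. *)
have wx1 : weighted S (compl b1 ^ D (- (0 + 1))%R) x.
  apply/weightedE; rewrite compl_conj compl_compl -{1}(expgz1 d) -conjgM -expgzD.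
  have -> : (1 + - (0 + 1) = 0 :> int)%R by lia.
  rewrite expgz0 conjg1.
  have [//|E] := le_atom ax (pos_meet (proper_pos pb1) (atom_pos ax)) (meet_ler _ _ _).
  by case: xb1; rewrite -E; exact: meet_lel.
(* A failure would be an exchange, which [reduced] excludes. *)
have wxb : weighted S x b1.
  apply: contrapT => H.
  have [e [ae eb sxe]] := not_weighted hom (atom_simple fin ax) (proper_pos pb1) H.
  exact: (exch e ae eb sxe).
have lasti : last 1 (inverse_chain S 0 (b1 :: b')) = compl b1 ^ D (- (0 + 1))%R.
  by rewrite /= last_rcons.
rewrite -/(inverse_chain S 0%R (b1 :: b')).
have := size_inverse_chain S 0%R (b1 :: b').
case: (inverse_chain _ _ _) lasti iW => //= i0 i' lasti iW _.
rewrite cat_path iW lasti; case: k k0 sqfk => //= k' _ sq.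
rewrite wx1 cat_path last_nseq /= wxb cat_path bW /= !path_nseq //.
- by move=> j2; apply: weighted_sq; [exact: sqfj | apply: ay; lia].
- by move=> k2; apply: weighted_sq => //; apply: sq; lia.
- by move=> k2; apply: weighted_sq => //; apply: sq; lia.
Qed.

Lemma product_lnf :
  is_left_normal_form S ((x ^+ k) ^ (\prod_(a <- b) a) * y ^+ j)
    (- Posz (size b))%R (inverse_chain S 0 b ++ nseq k x ++ b ++ nseq j y).
Proof.
apply/lnfE; split; last exact: product_chain.
rewrite !big_cat /= !big_nseq !iter_mulg_1 mulgA.
have := prod_inverse_chain S 0%R b; rewrite expgz0 mul1g add0r => <-.
by rewrite conjgE !mulgA.
Qed.

Lemma product_initial :
  meet ((x ^+ k) ^ (\prod_(a <- b) a) * y ^+ j * D (Posz (size b))) d = compl (last 1 b).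
Proof.
have := product_lnf; case/lastP: b b0 => // b' B _.
rewrite inverse_chain_rcons => /(lnf_initial fin).
by rewrite opprK size_rcons last_rcons add0r -conjgM -expgzD addNr expgz0 conjg1.
Qed.

End Chain.

Lemma inverse_chainE p (s : seq G) : inverse_chain S p s =
  [seq compl (nth 1 s i.-1) ^ D (- (p + Posz i))%R | i <- rev (iota 1 (size s))].
Proof.
elim: s p => [|a s IH] p //=.
rewrite rev_cons map_rcons /=; congr rcons.
rewrite IH !map_rev; congr rev; rewrite (iotaDl 1 1) -map_comp.
apply/eq_in_map => i; rewrite mem_iota => /andP[i0 _] /=.
congr (compl _ ^ D _); last by lia.
by case: i i0.
Qed.

(** Solving the equation for [A i] gives [d ^+ i * (B i)^-1 * d * d ^- i], the complement of [B i]
    conjugated by [d ^- i]. *)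
Lemma inverse_chain_compl_factors (s : seq G) : (forall a, a \in s -> simples S a) ->
  compl_factors S (size s) (fun i => compl (nth 1 s i.-1) ^ D (- (0 + Posz i))%R)
    (fun i => nth 1 s i.-1).
Proof.
move=> sP i /andP[i0 si]; have sa : simples S (nth 1 s i.-1).
  by apply: sP; apply: mem_nth; rewrite prednK.
split=> //; first exact/simple_conj/simple_compl.
case: i i0 si sa => // i _ _ _ /=.
move: (nth 1 s i) => a.
by rewrite /right_compl conjgE expgSr; grp.
Qed.

Lemma sandwichE k x (s : seq G) :
  sandwich (size s) k (fun i => compl (nth 1 s i.-1) ^ D (- (0 + Posz i))%R)
    (fun i => nth 1 s i.-1) x = inverse_chain S 0 s ++ nseq k x ++ s.
Proof.
rewrite /sandwich -inverse_chainE; congr (_ ++ (_ ++ _)).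
rewrite (iotaDl 1 0) -map_comp -[RHS](mkseq_nth 1).
by apply/eq_in_map => i _.
Qed.

Lemma compl_factors_prod n (A B : nat -> G) : compl_factors S n A B ->
  (\prod_(a <- [seq A i | i <- rev (iota 1 n)]) a) *
  (\prod_(a <- [seq B i | i <- iota 1 n]) a) = d ^+ n.
Proof.
elim: n => [|n IH] H; first by rewrite !big_nil mulg1.
have [|_ _ E] := H n.+1; first by lia.
rewrite -[n.+1]addn1 iotaD add1n /= cats1 rev_rcons /= map_rcons -cats1.
rewrite big_cat big_cons big_seq1 /=.
rewrite !mulgA -[A n.+1 * _ * _]mulgA IH ?E ?addn1 // => i /andP[i0 ni].
by apply: H; lia.
Qed.

(** The relations telescope: the product of the [A i] times the product of the [B i] is [d ^+ n], so
    the former cancels against [d ^- n] up to the inverse of the latter. *)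
Lemma sandwich_conj n k A B x : compl_factors S n A B ->
  exists V, D (- Posz n)%R * (\prod_(a <- sandwich n k A B x) a) = (x ^+ k) ^ V.
Proof.
move=> /compl_factors_prod; rewrite /sandwich !big_cat /= big_nseq iter_mulg_1.
set a := \prod_(_ <- map A _) _; set b := \prod_(_ <- map B _) _ => E; exists b.
have -> : D (- Posz n)%R = b^-1 * a^-1 by rewrite -invgM E expgzN.
by rewrite conjgE; grp.
Qed.

End ProductForm.

(** * Conjugates of an atom power, and part (a) *)

Section AtomPowers.
Variables (G : groupType) (S : garside G) (k : nat) (x : G).
Hypotheses (fin : finite_type S) (hom : homogeneous S) (sym : garside_symmetric S).
Hypotheses (ax : atoms S x) (k0 : (0 < k)%N) (sqf : (2 <= k)%N -> square_free S).
Implicit Types (a b c e g h u v X Y Q U V : G) (z : int) (n m i j : nat).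

Local Notation P := (pos S).
Local Notation d := (delta S).
Local Notation D := (expgz (delta S)).
Local Notation le := (prefix_le S).
Local Notation cls x := (conj_class x `&` atoms S).

(* For [Q] conjugate to [x ^+ k], this says that [- n <= lnf_inf Q]. *)
Definition power_depth n Q : Prop :=
  exists x1 V, [/\ cls x x1, P V, le V (D (Posz n)) & Q = (x1 ^+ k) ^ V].

Lemma conj_class_trans (u v w : G) : conj_class u v -> conj_class v w -> conj_class u w.
Proof. by move=> [a _ <-] [b _ <-]; exists (a * b) => //; rewrite conjgM. Qed.

Lemma conj_classJ (u g : G) : conj_class u (u ^ g).
Proof. by exists g. Qed.

Lemma clsJ y g : cls x y -> atoms S (y ^ g) -> cls x (y ^ g).
Proof. by move=> [xy _] a; split=> //; apply: conj_class_trans xy _; exact: conj_classJ. Qed.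

(** A power of [delta] makes the conjugator positive; it is compensated by conjugating [x], which
    remains an atom. *)
Lemma power_depth_ex Q : conj_class (x ^+ k) Q -> exists n, power_depth n Q.
Proof.
move=> [z _ <-]; have [m [_ mz]] := le_bounded fin z.
have [n [nz _]] := le_bounded fin (D (Posz m) * z).
exists n, (x ^ D (- Posz m)%R), (D (Posz m) * z); split=> //.
- split; first exact: conj_classJ.
  exact: atom_conjD.
- by have := mz; rewrite /prefix_le /pos_le expgzN invgK.
- by rewrite conjgM -!conjXg expgzN conjgKV.
Qed.

Lemma power_depth_reduced n Q : power_depth n Q -> exists x1 (b : seq G),
  [/\ cls x x1, chain S b, reduced S x1 (\prod_(a <- b) a),
      Q = (x1 ^+ k) ^ (\prod_(a <- b) a) & (size b <= n)%N].
Proof.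
move=> [x0 [U [[cx0 ax0] pU Un ->]]].
have [x1 [V [[cx1 ax1] pV Vn -> rV]]] := reduced_exists fin hom sym k ax0 pU Un.
have [b cb VE] := reduced_chain fin hom ax1 pV rV.
exists x1, b; rewrite -VE; split=> //; first by split=> //; exact: conj_class_trans cx1.
have lV : is_left_normal_form S V (Posz 0) b by apply/lnfE; rewrite expgz0 mul1g.
apply: contrapT => nb.
have d1 : d <> 1 := delta_neq1 fin ax.
apply: (lnf_sup_min fin d1 lV); apply: le_trans Vn _; apply: le_D2.
by clear -nb; lia.
Qed.

Lemma power_depth_chain (b : seq G) x1 : cls x x1 -> chain S b ->
  power_depth (size b) ((x1 ^+ k) ^ (\prod_(a <- b) a)).
Proof.
move=> cx1 cb; exists x1, (\prod_(a <- b) a); split=> //; first exact: chain_pos.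
by apply: prod_simples_le => // a ab; apply: proper_simple; exact: cb.1.
Qed.

Lemma power_depth_mono n m Q : (n <= m)%N -> power_depth n Q -> power_depth m Q.
Proof.
move=> nm [x1 [V [h1 h2 h3 h4]]]; exists x1, V; split=> //.
by apply: le_trans h3 _; apply: le_D2.
Qed.

Lemma power_formP X : conj_class (x ^+ k) X <-> power_form S k x X.
Proof.
split; last first.
  case=> [[n [x1 [A [B [[[w _ <-] _] AB /lnfE[-> _]]]]]]|[[[w _ wE] _] /lnfE[-> _]]].
    have [V ->] := sandwich_conj k (x ^ w) AB.
    by rewrite -conjXg -conjgM; exact: conj_classJ.
  by rewrite big_nil mulg1 -wE /= -conjXg; exact: conj_classJ.
move=> /power_depth_ex[n /power_depth_reduced[x1 [b [[cx1 ax1] cb rb -> bn]]]].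
(* The degenerate case: if [d] is an atom, no proper simple elements exist and the chain is
   empty. *)
have [x1d|/eqP x1d] := eqVneq x1 d.
  right; rewrite -x1d; split=> //; apply/lnfE; split; last by split.
  case: b cb rb {bn} => [|b0 b] cb [xb _].
    by rewrite !big_nil conjg1 mulg1 x1d.
  exfalso; have [pb _] := chain_cons cb.
  have ad : atoms S d by rewrite -x1d.
  have [E|E] := le_atom ad (proper_pos pb) (simple_le (proper_simple pb)).
    exact: proper_neq1 pb E.
  exact: proper_neqd pb E.
left; case: (ltnP 0 (size b)) => [b0|].
  (* There is no second power: with [j = 0] the conditions on the dummy [y = 1] are vacuous. *)
  have H : is_left_normal_form S ((x1 ^+ k) ^ (\prod_(a <- b) a))
      (- Posz (size b))%R (inverse_chain S 0%R b ++ nseq k x1 ++ b).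
    have := product_lnf fin hom ax1 (y := 1) (j := 0) _ k0 b0 sqf _ cb rb _.
    by rewrite expg0 mulg1 cats0; apply.
  exists (size b), x1, (fun i => right_compl S (nth 1 b i.-1) ^ D (- (0 + Posz i))%R),
    (fun i => nth 1 b i.-1); split=> //; last by rewrite sandwichE.
  by apply: inverse_chain_compl_factors => // a /cb.1 /proper_simple.
rewrite leqn0 => /eqP /size0nil bE; rewrite {}bE big_nil conjg1 in cb rb *.
exists 0%N, x1, (fun _ => 1), (fun _ => 1); split=> //; first by move=> i; lia.
rewrite /sandwich /= cats0; apply/lnfE; split.
  by rewrite big_nseq iter_mulg_1 oppr0 expgz0 mul1g.
split=> [a /nseqP[-> _]|].
  by apply: properI => //; [exact: atom_simple | exact: atom_neq1 ax1].
case: (k) k0 sqf => // k' _ sq; apply: path_nseq => k1; apply: weighted_sq => //; apply: sq; lia.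
Qed.

End AtomPowers.

(** * Products of two factors: positions of minimal depth and orbits reaching them *)

Section TwoFactors.
Variables (G : groupType) (S : garside G) (k l : nat) (x y : G).
Hypotheses (fin : finite_type S) (hom : homogeneous S) (sym : garside_symmetric S).
Hypotheses (ax : atoms S x) (k0 : (0 < k)%N) (l0 : (0 < l)%N).
Hypothesis sqf : (2 <= maxn k l)%N -> square_free S.
Variables (X P1 P2 : G).
Hypothesis XE : X = P1 * P2.
Implicit Types (a b c e g h t u v Y Q U V : G) (z : int) (n m i j : nat).

Local Notation P := (pos S).
Local Notation d := (delta S).
Local Notation D := (expgz (delta S)).
Local Notation le := (prefix_le S).
Local Notation meet := (meet S).
Local Notation compl := (right_compl S).
Local Notation degree := (degree S).
Local Notation cls x := (conj_class x `&` atoms S).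
Local Notation depth := (power_depth S k x).

(* With a minimal [n], these [t] are the positions at which [X] turns out to
   have the normal form of [product_form]. *)
Definition split_at n t y1 : Prop :=
  [/\ depth n (P1 ^ t), cls y y1 & P2 ^ t = y1 ^+ l].

Variable N : nat.
Hypothesis N0 : (0 < N)%N.
Hypothesis minN : forall n t y1, (n < N)%N -> ~ split_at n t y1.

Local Notation q := (Posz (N + k + l)).
Local Notation kapX := (kap S X (- Posz N)%R).
Local Notation decX := (dec S X q).
Local Notation sigX := (sig S X (- Posz N)%R q).

Let d1 : d <> 1 := delta_neq1 fin ax.

Lemma sqfk : (2 <= k)%N -> square_free S.
Proof. by move=> k2; apply: sqf; rewrite leq_max k2. Qed.

Lemma sqfl : (2 <= l)%N -> square_free S.
Proof. by move=> k2; apply: sqf; rewrite leq_max k2 orbT. Qed.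

Lemma split_conj t : X ^ t = P1 ^ t * P2 ^ t.
Proof. by rewrite XE conjMg. Qed.

Lemma rconsE (b : seq G) : (0 < size b)%N -> exists (b' : seq G) B, b = rcons b' B.
Proof. by case/lastP: b => // b' B _; exists b', B. Qed.

(** Minimality of [N] is used twice. A shorter conjugator would lower the depth at [t]; if the last
    factor [B] were not weighted with [y1], then [B * y1] would be simple, and at [t * B^-1] the
    atom would survive by exchange while the depth drops. *)
Lemma split_atE t y1 : split_at N t y1 -> exists x1 (b : seq G),
  [/\ cls x x1, chain S b, reduced S x1 (\prod_(a <- b) a),
      P1 ^ t = (x1 ^+ k) ^ (\prod_(a <- b) a) &
      size b = N /\ weighted S (last 1 b) y1].
Proof.
move=> T; have [dN cy1 P2E] := T.
have [x1 [b [cx1 cb rb P1E bN]]] := power_depth_reduced fin hom sym ax dN.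
have bE : size b = N.
  apply/eqP; rewrite eqn_leq bN /= leqNgt; apply/negP => bn.
  apply: (minN bn (t := t) (y1 := y1)); split=> //.
  by rewrite P1E; exact: power_depth_chain.
exists x1, b; split=> //; split=> //.
have b0 : (0 < size b)%N by rewrite bE.
have [b' [B E]] := rconsE b0; rewrite E in cb bE P1E *; rewrite last_rcons.
have [cb' pB _] := chain_rcons cb.
have ay1 : atoms S y1 by case: cy1.
apply: contrapT => H.
have [e [ae ey sBe]] := not_weighted hom (proper_simple pB) (atom_pos ay1) H.
have [E1|E1] := le_atom ay1 (atom_pos ae) ey; first by case: (atom_neq1 ae).
rewrite {}E1 in sBe.
have ay2 := atom_conjV_simple fin hom sym ay1 (proper_pos pB) sBe.
apply: (@minN (size b') (t * B^-1) (y1 ^ B^-1)).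
  by rewrite -bE size_rcons.
split; last by rewrite conjgM P2E conjXg.
  rewrite conjgM P1E -conjgM -cats1 big_cat big_seq1 /= mulgK.
  exact: power_depth_chain.
exact: clsJ.
Qed.

Lemma split_lnf t y1 : split_at N t y1 -> exists x1 (b : seq G),
  [/\ cls x x1, chain S b, size b = N &
  is_left_normal_form S (X ^ t) (- Posz N)%R
    (inverse_chain S 0 b ++ nseq k x1 ++ b ++ nseq l y1)].
Proof.
move=> T; have [_ [_ ay1] P2E] := T.
have [x1 [b [cx1 cb rb P1E [bN wb]]]] := split_atE T.
exists x1, b; split=> //; rewrite split_conj P1E P2E -{1}bN.
apply: product_lnf => //; first by case: cx1.
- by rewrite bN.
- exact: sqfk.
- exact: sqfl.
Qed.

Lemma split_product_form t y1 : split_at N t y1 -> product_form S k l x y (X ^ t).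
Proof.
move=> T; have [_ cy1 _] := T; have [x1 [b [cx1 cb bN H]]] := split_lnf T.
exists N, x1, y1, (fun i => compl (nth 1 b i.-1) ^ D (- (0 + Posz i))%R),
    (fun i => nth 1 b i.-1); split=> //.
  by rewrite -bN; apply: inverse_chain_compl_factors => // a /cb.1 /proper_simple.
by rewrite -{2}bN sandwichE -!catA.
Qed.

Lemma split_exact t y1 : split_at N t y1 ->
  lnf_inf S (X ^ t) = (- Posz N)%R /\
  (lnf_inf S (X ^ t) + Posz (ell S (X ^ t)) = q)%R.
Proof.
move=> /split_lnf[x1 [b [_ _ bN H]]].
have [-> sE] := lnf_unique fin d1 (left_normal_formP fin hom (X ^ t)) H.
split=> //; rewrite /ell sE !size_cat size_inverse_chain !size_nseq; lia.
Qed.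

Definition in_range g : Prop :=
  infge S X (- Posz N)%R g /\ infge S X^-1 (- q)%R g.

Lemma split_range t y1 : split_at N t y1 -> in_range t.
Proof.
move=> /split_exact[E1 E2]; split.
  by apply/(infgeE fin hom d1); rewrite E1.
by apply/(supleE fin hom d1); rewrite E2.
Qed.

Lemma range_kap g : in_range g -> in_range (kapX g).
Proof. by case=> ? ?; split; [exact: infge_kap | exact: infge_kapV']. Qed.

Lemma range_dec g : in_range g -> in_range (decX g).
Proof. by case=> ? ?; split; [exact: infge_dec | exact: infge_decV]. Qed.

Lemma range_meet g h : in_range g -> in_range h -> in_range (meet g h).
Proof. by case=> ? ? [? ?]; split; exact: infge_meet. Qed.

Lemma range_D g z : in_range (g * D z) <-> in_range g.
Proof. by rewrite /in_range !infgeD. Qed.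

Lemma kap_decX g : kapX (decX g) = sigX g.
Proof. by apply: kap_dec => //; lia. Qed.

Lemma split_dec t y1 : split_at N t y1 -> decX t = t * y1^-1.
Proof.
move=> T; have [E1 E2] := split_exact T; have [x1 [b [_ _ bN H]]] := split_lnf T.
rewrite /dec kapE opprK conjVg -E2 E1.
have lE : ell S (X ^ t) = (size (inverse_chain S 0%R b ++ nseq k x1 ++ b ++ nseq l.-1 y1)).+1.
  have [_] := lnf_unique fin d1 (left_normal_formP fin hom (X ^ t)) H.
  by rewrite /ell => ->; rewrite !size_cat !size_nseq; lia.
have nE : nseq l y1 = rcons (nseq l.-1 y1) y1.
  by rewrite -cats1 -[[:: y1]]/(nseq 1 y1) cat_nseq /ncons -iterD; congr iter; lia.
rewrite lE; rewrite nE -!rcons_cat in H.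
by rewrite (lnf_final fin H) /right_compl mulgA -[_ * d * _]mulgA delta_DN1 mulg1.
Qed.

Lemma split_delta t y1 z : split_at N t y1 -> split_at N (t * D z) (y1 ^ D z).
Proof.
move=> [[x1 [V [cx1 pV VN E]]] cy1 P2E]; split.
- exists (x1 ^ D z), (V ^ D z); split.
  + by apply: clsJ => //; apply: atom_conjD => //; case: cx1.
  + exact: pos_conj.
  + have := pos_conj fin z VN; rewrite conjMg conjVg.
    by rewrite [X in _ * X](_ : _ = D (Posz N)) // conjgE -expgzD addrC expgzD mulKg.
  + by rewrite conjgM E -conjXg -!conjgM -conjgC.
- by apply: clsJ => //; apply: atom_conjD => //; case: cy1.
- by rewrite conjgM P2E conjXg.
Qed.

Lemma expg_le (i : nat) (u : G) : (i <= l)%N -> u ^+ l = u ^+ i * u ^+ (l - i).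
Proof. by move=> il; rewrite -expgnDr subnKC. Qed.

Lemma conj_expV (u : G) i : (u ^+ l) ^ (u ^- i) = u ^+ l.
Proof. by rewrite conjgE invgK mulgA -expgnDr addnC expgnDr mulgK. Qed.

Lemma pos_expg (u : G) i : P u -> P (u ^+ i).
Proof. by move=> pu; elim: i => [|i IH]; [exact: pos1 | rewrite expgS; exact: posM]. Qed.

(* [meet_power] shows that only the first [y1] of [y1 ^+ i] enters the initial
   factor at [t * y1 ^- i]. *)
Lemma split_kap t y1 i : split_at N t y1 -> (0 < i <= l)%N ->
  exists t' y', split_at N t' y' /\ kapX (t * y1 ^- i) = t' * y' ^- i.-1.
Proof.
move=> T /andP[i0 il]; have [_ [cy1 ay1] P2E] := T.
have [x1 [b [cx1 cb rb P1E [bN wb]]]] := split_atE T.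
have b0 : (0 < size b)%N by rewrite bN.
have [b' [B bE]] := rconsE b0; rewrite bE last_rcons in cb rb P1E bN wb b0.
have [cb' pB _] := chain_rcons cb.
(* Both [y1 * c] and [B * c] are simple: conjugating by [c] keeps [y1] an atom, and the conjugator
   of the first factor absorbs [c] into its last factor without growing in length. *)
pose c := meet (compl y1) (compl B).
have sy1 := atom_simple fin ay1; have sB := proper_simple pB.
have pc : P c by apply: pos_meet; exact: pos_compl.
have syc : simples S (y1 * c).
  by apply/simple_mul => //; [exact: atom_pos | exact: meet_lel].
have sBc : simples S (B * c).
  by apply/simple_mul => //; [exact: simple_pos | exact: meet_ler].
have aY := atom_conj_simple fin hom sym ay1 pc syc.
have iE : meet ((x1 ^+ k) ^ (\prod_(a <- rcons b' B) a) * y1 ^+ (l - i) * D (Posz N)) d = compl B.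
  have := @product_initial _ _ fin hom x1 y1 k (l - i) (rcons b' B).
  rewrite bN last_rcons; apply=> //.
  - by case: cx1.
  - exact: sqfk.
  - by move=> ?; apply: sqfl; lia.
exists (t * c), (y1 ^ c); split.
  split.
  - exists x1, (\prod_(a <- rcons b' B) a * c); split=> //.
    + by apply: posM => //; exact: chain_pos.
    + have := @prod_simples_le _ _ fin (rcons b' (B * c)).
      rewrite size_rcons -bN size_rcons -!cats1 !big_cat !big_seq1 /= mulgA cats1.
      apply=> a; rewrite mem_rcons inE => /orP[/eqP->//|].
      by move/cb'.1/proper_simple.
    + by rewrite conjgM P1E -conjgM.
  - by apply: clsJ.
  - by rewrite conjgM P2E conjXg.
rewrite kapE opprK split_conj !conjgM P1E P2E conj_expV.
set Q := (x1 ^+ k) ^ _ in iE *.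
(* Here [y1 ^+ i] precedes an element with simple head [compl B], so by [meet_power] the total head
   is [y1 * c]. *)
have -> : Q ^ (y1 ^- i) * y1 ^+ l * D (Posz N) = y1 ^+ i * (Q * y1 ^+ (l - i) * D (Posz N)).
  by rewrite (expg_le y1 il) conjgE; grp.
rewrite meet_mul_delta ?iE; last by apply: pos_expg; exact: atom_pos.
rewrite (meet_power fin hom sym ay1 (simple_compl sB)) => //; last by move=> ?; apply: sqfl; lia.
rewrite -/c -conjXg; case: i i0 {il iE} => // i _.
rewrite expgS conjgE /=; grp.
Qed.

Lemma split_iter_kap t y1 i : split_at N t y1 -> (i <= l)%N ->
  exists t' y', split_at N t' y' /\ iter i kapX (t * y1 ^- i) = t'.
Proof.
elim: i t y1 => [|i IH] t y1 T il; first by exists t, y1; rewrite expg0 invg1 mulg1.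
have [t' [y' [T' E]]] := split_kap T (i := i.+1) il.
by rewrite iterSr E; exact: IH (ltnW il).
Qed.

Lemma split_sig t y1 : split_at N t y1 -> exists y', split_at N (sigX t) y'.
Proof.
move=> T; have [t' [y' [T' E]]] := split_kap T (i := 1) l0.
by exists y'; rewrite -kap_decX (split_dec T) -[y1]expg1 E expg0 invg1 mulg1.
Qed.

(** The element [v * compl u] is simple; its complement, conjugated by [delta^-1], is [u * v^-1], so
    [v] is a nontrivial suffix of the atom [u]. *)
Lemma prefix_of_compl (u v : G) : atoms S u -> proper_simples S v ->
  le (compl u) (compl v) -> v = u.
Proof.
move=> au pv uv; have sv := proper_simple pv.
have su := simple_compl (atom_simple fin au).
have svu : simples S (v * compl u) by apply/simple_mul => //; exact: simple_pos.
have : P (u * v^-1).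
  have := pos_conj fin (- 1)%R (pos_compl svu).
  rewrite /right_compl conjgE expgzN invgK expgz1.
  by have -> : d * ((v * (u^-1 * d))^-1 * d * d^-1) = u * v^-1 by grp.
move=> puv; case: (au) => _ _ /(_ _ _ puv (simple_pos sv)); rewrite mulgVK => /(_ erefl)[E|E].
  by apply/esym; rewrite -[u](mulgVK v) E mul1g.
by case: (proper_neq1 pv).
Qed.

(* [X ^ g = y2 ^+ i * P1 ^ (g * y2 ^+ i) * y2 ^+ (l - i)]; as long as the depth
   of the middle term exceeds [N], the bound on inf forces the last factor of
   its conjugator to be [y2], and lowering [i] removes that factor. *)
Lemma split_in_range g y2 : cls y y2 -> P2 ^ g = y2 ^+ l ->
  conj_class (x ^+ k) P1 -> infge S X (- Posz N)%R g ->
  exists i, (i <= l)%N /\ split_at N (g * y2 ^+ i) y2.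
Proof.
move=> cy2 P2E cP1 rg; have ay2 : atoms S y2 by case: cy2.
have P2i i : P2 ^ (g * y2 ^+ i) = y2 ^+ l.
  by rewrite conjgM P2E conjgE -expgnDr addnC expgnDr mulKg.
suff main i (b : seq G) x1 : (i <= l)%N -> cls x x1 -> chain S b ->
    reduced S x1 (\prod_(a <- b) a) ->
    P1 ^ (g * y2 ^+ i) = (x1 ^+ k) ^ (\prod_(a <- b) a) ->
    ((i < l)%N -> (0 < size b)%N -> weighted S (last 1 b) y2) ->
    exists j, (j <= l)%N /\ depth N (P1 ^ (g * y2 ^+ j)).
  have cP1l : conj_class (x ^+ k) (P1 ^ (g * y2 ^+ l)).
    by apply: conj_class_trans cP1 _; exact: conj_classJ.
  have [n dn] := power_depth_ex fin hom ax cP1l.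
  have [x1 [b [cx1 cb rb P1E _]]] := power_depth_reduced fin hom sym ax dn.
  have [|i [il di]] := main l b x1 (leqnn l) cx1 cb rb P1E; first by rewrite ltnn.
  by exists i; split=> //; split.
elim: i b x1 => [|i IH] b x1 il cx1 cb rb P1E wb.
all: have [bN|Nb] := leqP (size b) N.
1,3: eexists; split; [exact: il | rewrite P1E].
1,2: by apply: power_depth_mono bN _; exact: power_depth_chain.
all: have b0 : (0 < size b)%N by exact: leq_ltn_trans Nb.
all: have [b' [B bE]] := rconsE b0; rewrite bE last_rcons in cb rb P1E Nb wb b0.
all: have [cb' pB wB] := chain_rcons cb.
all: have ax1 : atoms S x1 by case: cx1.
all: have sB := proper_simple pB.
(* At [i = 0] the head is [compl B]; with more than [N] factors the bound on inf makes it [d],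
   whence [B = 1]. *)
- have := @product_initial _ _ fin hom x1 y2 k l (rcons b' B).
  rewrite last_rcons => /(_ ax1 (fun _ => ay2) k0 b0 sqfk sqfl cb rb (fun _ => wb l0 b0)).
  rewrite -P1E expg0 mulg1 -P2E -split_conj meet_idr => [E|].
    have := proper_neq1 pB; case; apply: invg_inj; apply: (mulIg d).
    by rewrite invg1 mul1g; exact: esym E.
  have := (le_mulD fin _ _ (Posz (size (rcons b' B)))).2 ((conj_le _ _ _ _).1 rg).
  apply: le_trans; rewrite -expgzD -{1}(expgz1 d); apply: le_D2; lia.
have iE : meet (P1 ^ (g * y2 ^+ i.+1) * y2 ^+ (l - i.+1)
    * D (Posz (size (rcons b' B)))) d = compl B.
  have := @product_initial _ _ fin hom x1 y2 k (l - i.+1) (rcons b' B).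
  rewrite last_rcons P1E; apply=> //.
  + exact: sqfk.
  + by move=> ?; apply: sqfl; lia.
  + by move=> ?; apply: wb => //; lia.
have XgE : X ^ g = y2 ^+ i.+1 * (P1 ^ (g * y2 ^+ i.+1) * y2 ^+ (l - i.+1)).
  rewrite split_conj P2E conjgM (expg_le y2 il).
  by rewrite [_ ^ (y2 ^+ i.+1)]conjgE; grp.
have : meet (X ^ g * D (Posz (size (rcons b' B)))) d = d.
  apply: meet_idr.
  have := (le_mulD fin _ _ (Posz (size (rcons b' B)))).2 ((conj_le _ _ _ _).1 rg).
  apply: le_trans; rewrite -expgzD -{1}(expgz1 d); apply: le_D2; lia.
rewrite XgE -mulgA meet_mul_delta ?iE; last by apply: pos_expg; exact: atom_pos.
rewrite (meet_power fin hom sym ay2 (simple_compl sB)) => //; last by move=> ?; apply: sqfl; lia.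
(* That the head [y2 * meet (compl y2) (compl B)] equals [d] puts [compl y2] below [compl B]. *)
move=> E; have BE : B = y2.
  apply: prefix_of_compl => //.
  have <- : meet (compl y2) (compl B) = compl y2.
    by apply: (mulgI y2); rewrite E /right_compl mulVKg.
  exact: meet_ler.
apply: (IH b' x1 (ltnW il) cx1 cb').
- apply: reducedW rb; rewrite -cats1 big_cat big_seq1; apply: le_mul.
  exact: simple_pos.
- have -> : g * y2 ^+ i = (g * y2 ^+ i.+1) * B^-1 by rewrite BE expgSr mulgA mulgK.
  by rewrite conjgM P1E -conjgM -cats1 big_cat big_seq1 mulgK.
- by move=> _; rewrite -BE.
Qed.

Definition reaches g : Prop := exists i j t' y',
  split_at N t' y' /\ iter i kapX (iter j decX g) = t'.

Hypothesis cP1 : conj_class (x ^+ k) P1.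

(** From [decX g] the positions [g] and [t] are reached by [f] and [s1 * y1]. If [s1 * y1] is
    simple, the exchange makes [P2] an atom power at [decX g]; otherwise it does so at [g]. *)
Lemma split_reaches_near t y1 g : split_at N t y1 -> in_range g ->
  le g t -> le t (g * d) -> reaches g.
Proof.
move=> T [rg rg'] gt tgd; have [_ [cy1 ay1] P2E] := T.
have dtE := split_dec T; have py1 := atom_pos ay1.
pose s1 := (decX g)^-1 * (t * y1^-1).
have ps1 : P s1 by rewrite /s1 -dtE; exact: (dec_mono fin X q gt).
have ss1 : le s1 d.
  have decd := decD fin X q g 1%R; rewrite expgz1 in decd.
  by rewrite -(le_mul2l _ (decX g)) mulVKg -dtE -decd; exact: dec_mono.
pose f := (decX g)^-1 * g.
have pf : P f by exact: (dec_le fin X q g).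
have fd : le f d by rewrite -(le_mul2l _ (decX g)) mulVKg; exact: le_dec.
have sy : s1 * y1 = (decX g)^-1 * t by rewrite /s1; grp.
have [sS|nS] := pselect (simples S (s1 * y1)).
  have ay2 := atom_conjV_simple fin hom sym ay1 ps1 sS.
  have E2 : P2 ^ (decX g) = (y1 ^ s1^-1) ^+ l.
    have -> : decX g = t * y1^-1 * s1^-1 by rewrite /s1; grp.
    rewrite conjgM [P2 ^ _]conjgM P2E !conjXg; congr ((_ ^ _) ^+ l).
    by rewrite conjgE; grp.
  have cy2 : cls y (y1 ^ s1^-1) by exact: clsJ.
  have [i [il Ti]] := split_in_range cy2 E2 cP1 (infge_dec fin q rg).
  have [t' [y' [T' itE]]] := split_iter_kap Ti il.
  by exists i, 1%N, t', y'; split=> //; rewrite -itE mulgK.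
(* The simple head of [s1 * y1] lies between [s1] and [s1 * y1], hence is [s1], and [f] is a simple
   prefix of [s1 * y1]. *)
have fs1 : le f s1.
  have fm : le f (meet (s1 * y1) d).
    apply/le_meet; split=> //.
    by rewrite sy -(le_mul2l _ (decX g)) !mulVKg.
  have sm : le s1 (meet (s1 * y1) d) by apply/le_meet; split=> //; exact: le_mul.
  have [E|E] := le_mul_atom ay1 sm (meet_lel _ _ _); first by rewrite E in fm.
  case: nS; apply/simplesE; split; first exact: posM.
  by rewrite -E; exact: meet_ler.
pose e := f^-1 * s1.
have eE : g^-1 * t = e * y1 by rewrite /e -mulgA sy /f; grp.
have sey : simples S (e * y1).
  apply/simplesE; rewrite -eE; split; first exact: gt.
  by rewrite -(le_mul2l _ g) mulVKg.
have ay2 := atom_conjV_simple fin hom sym ay1 (fs1 : P e) sey.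
have E2 : P2 ^ g = (y1 ^ e^-1) ^+ l.
  have -> : g = t * y1^-1 * e^-1 by apply: (mulIg (e * y1)); rewrite -{1}eE mulVKg; grp.
  rewrite conjgM [P2 ^ _]conjgM P2E !conjXg; congr ((_ ^ _) ^+ l).
  by rewrite conjgE; grp.
have cy2 : cls y (y1 ^ e^-1) by exact: clsJ.
have [i [il Ti]] := split_in_range cy2 E2 cP1 rg.
have [t' [y' [T' itE]]] := split_iter_kap Ti il.
by exists i, 0%N, t', y'; split=> //; rewrite -itE mulgK.
Qed.

(** As [kapX] and [decX] commute, walks compose by adding both step counts; diagonal walks are
    iterated slidings. *)
Definition walk i j g := iter i kapX (iter j decX g).

Lemma iter_kap_dec i j g : iter i kapX (iter j decX g) = iter j decX (iter i kapX g).
Proof.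
elim: i => //= i ->; move: (iter i kapX g) => h.
by elim: j => //= j <-; exact: kap_decC.
Qed.

Lemma walk_walk i j i' j' g : walk i j (walk i' j' g) = walk (i + i') (j + j') g.
Proof. by rewrite /walk -iter_kap_dec -!iterD. Qed.

Lemma walk_ind (Q : G -> Prop) i j g :
  (forall h, Q h -> Q (kapX h)) -> (forall h, Q h -> Q (decX h)) -> Q g -> Q (walk i j g).
Proof.
move=> Qk Qd Qg; rewrite /walk; elim: i => [|i IH] /=; last exact: Qk.
by elim: j => [|j IH] //=; exact: Qd.
Qed.

Lemma walk_mono i j g h : le g h -> le (walk i j g) (walk i j h).
Proof.
move=> gh; rewrite /walk; elim: i => [|i IH] /=; last exact: kap_mono.
by elim: j => [|j IH] //=; exact: dec_mono.
Qed.

Lemma walk_delta i j g : walk i j (g * d) = walk i j g * d.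
Proof.
have kd h : kapX (h * d) = kapX h * d by have := kapD fin X (- Posz N)%R h 1%R; rewrite expgz1.
have dd h : decX (h * d) = decX h * d by have := decD fin X q h 1%R; rewrite expgz1.
rewrite /walk; elim: i => [|i IH] /=; last by rewrite IH kd.
by elim: j => [|j IH] //=; rewrite IH dd.
Qed.

Lemma walk_sig j g : walk j j g = iter j sigX g.
Proof.
elim: j => [//|j IH]; rewrite -[j.+1]add1n -walk_walk IH iterD /walk /=.
exact: kap_decX.
Qed.

Lemma walk_range i j g : in_range g -> in_range (walk i j g).
Proof. by apply: walk_ind => h; [exact: range_kap | exact: range_dec]. Qed.

Lemma reachesE g : reaches g <-> exists i j y', split_at N (walk i j g) y'.
Proof.
split=> [[i [j [t' [y' [T E]]]]]|[i [j [y' T]]]]; first by exists i, j, y'; rewrite /walk E.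
by exists i, j, (walk i j g), y'.
Qed.

(** The walk that brings [h] to a split position is applied to [g] as well; being monotone and
    commuting with [delta], it keeps the two close enough for [split_reaches_near]. *)
Lemma reaches_step g h : reaches h -> in_range g -> le g h -> le h (g * d) -> reaches g.
Proof.
move=> /reachesE[i [j [y' T]]] rg gh hg.
have := split_reaches_near T (walk_range i j rg) (walk_mono i j gh).
rewrite -walk_delta => /(_ (walk_mono i j hg)) /reachesE[i' [j' [y'' T']]].
by apply/reachesE; exists (i' + i)%N, (j' + j)%N, y''; rewrite -walk_walk.
Qed.

Lemma reaches_le n g t : reaches t -> in_range t -> in_range g ->
  le g t -> le t (g * D (Posz n)) -> reaches g.
Proof.
elim: n g => [|n IH] g Rt rt rg gt tg.
  by rewrite expgz0 mulg1 in tg; rewrite (le_anti gt tg).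
have gg : le g (g * d) by apply: le_mul; exact: pos_delta.
(* This intermediate position is within one [delta] of [g] and within [n] of [t]. *)
apply: (reaches_step (h := meet t (g * d))) => //.
- apply: IH => //.
  + by apply: range_meet => //; have := (range_D g 1%R).2 rg; rewrite expgz1.
  + exact: meet_lel.
  + rewrite (meetMD fin) -mulgA; apply/le_meet; split.
      by apply: le_mulDr; exact: le_refl.
    by move: tg; rewrite /= expgS.
- by apply/le_meet.
- exact: meet_ler.
Qed.

Hypothesis exN : exists t y1, split_at N t y1.

Lemma range_reaches g : in_range g -> reaches g.
Proof.
move=> rg; have [t [y1 T]] := exN.
have [n [_ nt]] := le_bounded fin (g^-1 * t).
(* Split positions may be shifted by powers of [delta], here far enough to lie above [g]. *)
have T' := split_delta (Posz n) T; set t' := t * _ in T'.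
have gt : le g t'.
  rewrite -(le_mul2l _ g^-1) mulVg /t' mulgA -(le_mulD fin _ _ (- Posz n)%R) mul1g.
  by rewrite expgzN mulgK -expgzN.
have [m [tm _]] := le_bounded fin (g^-1 * t').
apply: (reaches_le (n := m) (t := t')) => //; last by rewrite -(le_mul2l _ g^-1) mulKg.
- by apply/reachesE; exists 0%N, 0%N, (y1 ^ D (Posz n)).
- exact: split_range T'.
Qed.

(** Stricter bounds at [g] would persist along the walk to a split position, where both bounds are
    attained. *)
Lemma range_exact g : in_range g ->
  lnf_inf S (X ^ g) = (- Posz N)%R /\
  (lnf_inf S (X ^ g) + Posz (ell S (X ^ g)) = q)%R.
Proof.
move=> rg; have [rg1 rg2] := rg.
have /reachesE[i [j [y' T]]] := range_reaches rg; have [E1 E2] := split_exact T.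
have h1 := (infgeE fin hom d1 _ _ _).1 rg1; have h2 := (supleE fin hom d1 _ _ _).1 rg2.
have e1 : lnf_inf S (X ^ g) = (- Posz N)%R.
  have [//|ne] := eqVneq (lnf_inf S (X ^ g)) (- Posz N)%R.
  have /(infgeE fin hom d1) : infge S X (- Posz N + 1)%R (walk i j g).
    apply: walk_ind; [by move=> h; exact: infge_kap | by move=> h; exact: infge_dec |].
    by apply/(infgeE fin hom d1); lia.
  by rewrite E1; lia.
split=> //.
have [//|ne] := eqVneq (lnf_inf S (X ^ g) + Posz (ell S (X ^ g)))%R q.
have /(supleE fin hom d1) : infge S X^-1 (- (q - 1))%R (walk i j g).
  apply: walk_ind; [by move=> h; exact: infge_kapV' | by move=> h; exact: infge_decV |].
  by apply/(supleE fin hom d1); lia.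
by rewrite E2; lia.
Qed.

Lemma range_cycling g : in_range g -> cycling S (X ^ g) = X ^ kapX g.
Proof. by move=> /range_exact[E _]; rewrite cyclingE // E. Qed.

Lemma range_decycling g : in_range g -> decycling S (X ^ g) = X ^ decX g.
Proof. by move=> /range_exact[_ E]; rewrite decyclingE // E. Qed.

Lemma range_sliding g : in_range g -> sliding S (X ^ g) = X ^ sigX g.
Proof. by move=> /range_exact[E1 E2]; rewrite slidingE // E2 E1. Qed.

Lemma iter_cycling i g : in_range g -> iter i (cycling S) (X ^ g) = X ^ walk i 0 g.
Proof.
by move=> rg; elim: i => //= i ->; rewrite range_cycling //; exact: walk_range.
Qed.

Lemma iter_decycling i g : in_range g -> iter i (decycling S) (X ^ g) = X ^ walk 0 i g.
Proof.
by move=> rg; elim: i => //= i ->; rewrite range_decycling //; exact: (walk_range 0).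
Qed.

Lemma iter_sliding i g : in_range g -> iter i (sliding S) (X ^ g) = X ^ walk i i g.
Proof.
move=> rg; rewrite walk_sig; elim: i => //= i ->; rewrite range_sliding //.
by rewrite -walk_sig; exact: walk_range.
Qed.

Lemma walk_product_form i j m g y' : split_at N (walk i j g) y' ->
  product_form S k l x y (X ^ walk (i + m) (j + m) g).
Proof.
move=> T; suff [y'' T'] : exists y'', split_at N (walk (i + m) (j + m) g) y''.
  exact: split_product_form T'.
rewrite ![(_ + m)%N]addnC -walk_walk walk_sig.
elim: m => [|m [y'' IH]] /=; first by exists y'.
exact: split_sig IH.
Qed.

Lemma circuit_orbits g m : in_range g -> (0 < m)%N ->
  iter m (sliding S) (X ^ g) = X ^ g ->
  (exists2 Z, cycling_orbit S (X ^ g) Z & product_form S k l x y Z) /\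
  (exists2 Z, decycling_orbit S (X ^ g) Z & product_form S k l x y Z).
Proof.
(* A doubly indexed orbit, [i] counting cyclings and [j] decyclings; the hypothesis is periodicity
   along the diagonal. *)
move=> rg m0 per; pose E i j := X ^ walk i j g.
have cE i i' j : iter i (cycling S) (E i' j) = E (i + i')%N j.
  by rewrite /E iter_cycling ?walk_walk //; exact: walk_range.
have dE i j j' : iter j (decycling S) (E i j') = E i (j + j')%N.
  by rewrite /E iter_decycling ?walk_walk //; exact: walk_range.
have perE n : E (m * n)%N (m * n)%N = E 0%N 0%N.
  rewrite /E -iter_sliding // mulnC; elim: n => // n IH.
  by rewrite mulSn iterD IH.
have [r rP] := interval_finite fin hom d1 (- Posz N)%R q.
have Er i j : E i j \in r.
  have [h1 h2] := walk_range i j rg; apply: rP; first exact/conj_le.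
  by rewrite -[E i j]invgK le_inv // -conjVg; exact/conj_le.
(* Pigeonhole gives a repetition [E 0 i = E 0 j]. Further cyclings and decyclings complete [E 0 i]
   to a multiple of the diagonal period, so the repetition extends back to the start. *)
have [p p0 pE] : exists2 p, (0 < p)%N & forall n, E 0%N (p * n)%N = E 0%N 0%N.
  have [i [j [ij ijE]]] := pigeonhole (Er 0%N).
  exists (j - i)%N; first by rewrite subn_gt0.
  elim=> [|n IH]; first by rewrite muln0.
  rewrite mulnS addnC -dE -[E 0%N (j - i)%N]/(E (0 + 0)%N _).
  have <- : E (m * i)%N (m * i + (j - i))%N = E 0%N (j - i)%N.
    by rewrite addnC -dE perE dE addn0.
  have -> : (m * i + (j - i) = (m * i - i) + j)%N by nia.
  have -> : E (m * i)%N (m * i - i + j)%N = E 0%N 0%N.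
    rewrite -dE -[X in E X _]addn0 -cE -ijE cE dE addn0.
    by rewrite (_ : (m * i - i + i = m * i)%N) ?perE //; nia.
  by rewrite dE addn0 IH.
have [p' p'0 p'E] : exists2 p, (0 < p)%N & forall n, E (p * n)%N 0%N = E 0%N 0%N.
  have [i [j [ij ijE]]] := pigeonhole (fun i => Er i 0%N).
  exists (j - i)%N; first by rewrite subn_gt0.
  elim=> [|n IH]; first by rewrite muln0.
  rewrite mulnS addnC -cE.
  have <- : E (m * i + (j - i))%N (m * i)%N = E (j - i)%N 0%N.
    by rewrite addnC -cE perE cE addn0.
  have -> : (m * i + (j - i) = (m * i - i) + j)%N by nia.
  have -> : E (m * i - i + j)%N (m * i)%N = E 0%N 0%N.
    rewrite -cE -[X in E _ X]addn0 -dE -ijE dE cE addn0.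
    by rewrite (_ : (m * i - i + i = m * i)%N) ?perE //; nia.
  by rewrite cE addn0 IH.
have /reachesE[i [j [y' T]]] := range_reaches rg.
have pf n : product_form S k l x y (E (i + n)%N (j + n)%N) by exact: walk_product_form T.
split.
  (* With [p.-1 * j] extra slidings the number of decyclings becomes [p * j], a multiple of their
     period. *)
  exists (E (i + (p.-1 * j))%N 0%N).
    by exists (i + (p.-1 * j))%N => //; rewrite -[X ^ g]/(E 0%N 0%N) cE addn0.
  have := pf (p.-1 * j)%N; rewrite -mulSn prednK // -[X in E X _]addn0 -cE pE cE addn0.
  by [].
exists (E 0%N (j + (p'.-1 * i))%N).
  by exists (j + (p'.-1 * i))%N => //; rewrite -[X ^ g]/(E 0%N 0%N) dE addn0.
have := pf (p'.-1 * i)%N; rewrite -[(i + _)%N]mulSn prednK // -[X in E _ X]addn0 -dE p'E dE addn0.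
by [].
Qed.

End TwoFactors.

(** * Sliding circuits and the drift argument *)

Section Circuits.
Variables (G : groupType) (S : garside G).
Hypotheses (fin : finite_type S) (hom : homogeneous S) (delta1 : delta S <> 1).
Implicit Types (g h t X W Z : G) (p q r z : int) (m n i j : nat).

Local Notation P := (pos S).
Local Notation d := (delta S).
Local Notation D := (expgz (delta S)).
Local Notation le := (prefix_le S).
Local Notation degree := (degree S).
Local Notation lnf_sup X := (lnf_inf S X%g + Posz (ell S X%g))%R.

Lemma sliding_conj Z : exists h, sliding S Z = Z ^ h.
Proof.
rewrite -[Z]conjg1 slidingE //; move: (sig _ _ _ _ _) => h; exists h.
by rewrite conjg1.
Qed.

Lemma iter_sliding_conj i Z : conj_class Z (iter i (sliding S) Z).
Proof.
elim: i => [|i [w _ E]] /=; first by exists 1 => //; rewrite conjg1.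
by rewrite -E; have [h ->] := sliding_conj (Z ^ w); exists (w * h) => //; rewrite conjgM.
Qed.

Lemma sliding_bounds Z : (lnf_inf S Z <= lnf_inf S (sliding S Z))%R /\
  (lnf_sup (sliding S Z) <= lnf_sup Z)%R.
Proof.
rewrite -[Z]conjg1 slidingE //; split.
  by apply/(infgeE fin hom delta1)/infge_sig => //; apply/(infgeE fin hom delta1).
by apply/(supleE fin hom delta1)/infge_sigV => //; apply/(supleE fin hom delta1).
Qed.

Lemma iter_sliding_bounds i Z : (lnf_inf S Z <= lnf_inf S (iter i (sliding S) Z))%R /\
  (lnf_sup (iter i (sliding S) Z) <= lnf_sup Z)%R.
Proof.
elim: i => [|i [h1 h2]] //=; have [h3 h4] := sliding_bounds (iter i (sliding S) Z); lia.
Qed.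

Lemma sliding_circuit_exists X : exists Y, sliding_circuits S X Y.
Proof.
have [r rP] := interval_finite fin hom delta1 (lnf_inf S X) (lnf_sup X).
have sr i : iter i (sliding S) X \in r.
  have [h1 h2] := iter_sliding_bounds i X.
  by apply: rP; [apply/(infE fin hom delta1) | apply/(supE fin hom delta1)].
have [i [j [ij E]]] := pigeonhole sr; exists (iter i (sliding S) X).
split; first exact: iter_sliding_conj.
by exists (j - i)%N; rewrite ?subn_gt0 // -iterD subnK // ltnW.
Qed.

Section Exactness.
Variables (X g : G) (m : nat).
Hypotheses (m0 : (0 < m)%N) (per : iter m (sliding S) (X ^ g) = X ^ g).

(** Inf never decreases and sup never increases under sliding, so both are constant on a circuit. *)
Lemma circuit_exact j :
  lnf_inf S (iter j (sliding S) (X ^ g)) = lnf_inf S (X ^ g) /\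
  lnf_sup (iter j (sliding S) (X ^ g)) = lnf_sup (X ^ g).
Proof.
have perj : iter (m * j) (sliding S) (X ^ g) = X ^ g.
  by rewrite mulnC; elim: j => // n IH; rewrite mulSn iterD IH.
have [h1 h2] := iter_sliding_bounds j (X ^ g).
have := iter_sliding_bounds (m * j - j) (iter j (sliding S) (X ^ g)).
have jm : (j <= m * j)%N by rewrite leq_pmull.
by rewrite -iterD subnK // perj; lia.
Qed.

Lemma circuit_sig j : iter j (sliding S) (X ^ g) =
  X ^ iter j (sig S X (lnf_inf S (X ^ g)) (lnf_sup (X ^ g))) g.
Proof.
elim: j => //= j IH; have [E1 E2] := circuit_exact j; rewrite IH in E1 E2 *.
by rewrite slidingE // E2 E1.
Qed.

End Exactness.

(* Along the cyclings of [g] the infimum stays minimal, so each of them is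
   strictly below right multiplication by [d], which is what cycling with
   parameter [p] does to [t]; the two orbits would drift apart. *)
Lemma infge_contra X p r g t :
  (forall j, ~ infge S X (p + 1)%R (iter j (sig S X p r) g)) -> (p + 2 <= r)%R ->
  ~ infge S X (p + 1)%R t.
Proof.
move=> ng pr it; pose K := kap S X p; pose F := dec S X r.
(* An iterated sliding is an iterated [F] applied to an iterated [K], and [F] preserves bounds on
   inf. *)
have nK j : ~ infge S X (p + 1)%R (iter j K g).
  have E : iter j (sig S X p r) g = iter j F (iter j K g).
    elim: j => //= j ->; rewrite -kap_dec // -/K -/F.
    have KF n h : K (iter n F h) = iter n F (K h).
      by elim: n => //= n <-; rewrite /K /F kap_decC.
    by rewrite -[F (iter j F _)]iterS KF.
  move=> H; apply: (ng j); rewrite E; move: (iter j K g) H => h H.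
  by elim: (j) => //= i IH; exact: infge_dec.
have [n [_ nt]] := le_bounded fin (g^-1 * t).
pose t' := t * D (Posz n).
have gt : le g t'.
  rewrite -(le_mul2l _ g^-1) mulVg /t' mulgA -(le_mulD fin _ _ (- Posz n)%R) mul1g.
  by rewrite expgzN mulgK -expgzN.
have [m [tm _]] := le_bounded fin (g^-1 * t').
have {}tm : le t' (g * D (Posz m)) by rewrite -(le_mul2l _ g^-1) mulKg.
have it' : infge S X (p + 1)%R t' by apply/infgeD.
clearbody t'.
have Kt j : le (t' * D (Posz j)) (iter j K g * D (Posz m)).
  elim: j => [|j IH]; first by rewrite expgz0 mulg1.
  have Kt' : kap S X p t' = t' * d by apply/(kap_full fin).
  have := kap_mono fin X p IH; rewrite !kapD // Kt' -mulgA.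
  by have -> : d * D (Posz j) = D (Posz j.+1) by rewrite /= expgS.
(* Each step of [K] from [g] falls short of a full [delta] and so loses at least one degree. *)
have dg j : (degree (iter j K g) + Posz j <= degree g + degree d * Posz j)%R.
  elim: j => [|j IH]; first by rewrite mulr0 !addr0.
  have le1 := kap_le S X p (iter j K g).
  have := le_degree fin hom le1; rewrite (degreeM fin hom) /= -/(K _) => le2.
  have [E|ne] := eqVneq (degree (K (iter j K g))) (degree (iter j K g) + degree d)%R; last by lia.
  case: (nK j); apply/(kap_full fin).
  by apply: (le_degree_eq fin hom le1); rewrite (degreeM fin hom).
(* More steps than the degree gap that [Kt] leaves between the two orbits. *)
pose J := `|(degree g + degree d * Posz m - degree t')%R|%N.+1.
have := le_degree fin hom (Kt J); rewrite !(degreeM fin hom) !(degreeD fin hom).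
by have := dg J; rewrite /J; lia.
Qed.

End Circuits.

(** * Assembly: minimal depth, bounds on sliding circuits, and the converse *)

Theorem theorem1 (G : groupType) (S : garside G) (k l : nat) (X x y : G) :
  garside_symmetric S -> homogeneous S -> finite_type S ->
  (0 < k)%N -> (0 < l)%N -> atoms S x -> atoms S y ->
  (((2 <= k)%N -> square_free S) ->
     (conj_class (x ^+ k) X <-> power_form S k x X))
  /\
  (((2 <= maxn k l)%N -> square_free S) ->
     (set_mulg (conj_class (x ^+ k)) (conj_class (y ^+ l)) X <->
        (exists x1 y1,
           [/\ (conj_class x `&` atoms S) x1, (conj_class y `&` atoms S) y1 &
               conj_class (x1 ^+ k * y1 ^+ l) X])
        \/
        (forall Y, sliding_circuits S X Y ->
           (exists2 Z, cycling_orbit S Y Z & product_form S k l x y Z)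
           /\
           (exists2 Z, decycling_orbit S Y Z & product_form S k l x y Z)))).
Proof.
move=> sym hom fin k0 l0 ax ay; split; first by move=> sqf; exact: power_formP.
move=> sqf; have d1 := delta_neq1 fin ax.
have mulJ Z z : set_mulg (conj_class (x ^+ k)) (conj_class (y ^+ l)) Z ->
    set_mulg (conj_class (x ^+ k)) (conj_class (y ^+ l)) (Z ^ z).
  move=> [u [a _ <-] [v [b _ <-] <-]]; exists ((x ^+ k) ^ (a * z)); first by exists (a * z).
  exists ((y ^+ l) ^ (b * z)); first by exists (b * z).
  by rewrite conjMg !conjgM.
split=> [[P1 cP1 [P2 cP2 XE]]|].
  have {}XE := esym XE; pose T n := `[< exists t y1, split_at S k l x y P1 P2 n t y1 >].
  have exT : exists n, T n.
    have [z _ zE] := cP2.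
    have [n dn] := power_depth_ex fin hom ax (conj_class_trans cP1 (conj_classJ P1 z^-1)).
    exists n; apply/asboolP; exists z^-1, y; split=> //.
      by split=> //; exists 1 => //; rewrite conjg1.
    by rewrite -zE conjgK.
  case: (ex_minnP exT) => N /asboolP[t [y1 TN]] minT.
  have minN n t' y' : (n < N)%N -> ~ split_at S k l x y P1 P2 n t' y'.
    move=> nN T'; have /minT : T n by apply/asboolP; exists t', y'.
    by rewrite leqNgt nN.
  have [N0|N0] := posnP N.
    left; move: TN; rewrite N0 => -[[x1 [V [cx1 pV V1 P1E]]] cy1 P2E].
    exists x1, y1; split=> //; exists t^-1 => //.
    have V1' : V = 1 by apply: (le_anti (S := S)) => //; apply/le1.
    by rewrite -P2E -[_ ^+ k]conjg1 -V1' -P1E -conjMg -XE conjgK.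
  right=> Y [[g _ <-] [m m0 per]].
  apply: (circuit_orbits fin hom sym ax k0 l0 sqf XE N0 minN cP1 _ _ m0 per).
    by exists t, y1.
  have [rt1 rt2] := split_range fin hom sym ax k0 l0 sqf XE N0 minN TN.
  pose p := lnf_inf S (X ^ g); pose r := (p + Posz (ell S (X ^ g)))%R.
  have ex j := circuit_exact fin hom d1 m0 per j.
  have sg j := circuit_sig fin hom d1 m0 per j.
  have dX : degree S (X ^ g) = Posz (k + l).
    have [z1 _ E1] := cP1; have [z2 _ E2] := cP2.
    rewrite (degreeJ fin hom) XE (degreeM fin hom) -E1 -E2 !(degreeJ fin hom).
    by rewrite !(degreeX fin hom) !(atom_degree fin hom) // !mul1r.
  have dd : (0 < degree S (delta S))%R by apply: (degree_gt0 hom) => //; exact: pos_delta.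
  (* Comparing degrees bounds [p] above and [r] below; if [X ^ g] is out of range, this forces
     [r - p] to be at least 2, as [infge_contra] requires. *)
  have pX : (degree S (delta S) * p <= Posz (k + l))%R.
    by rewrite -dX -(degreeD fin hom); apply: (le_degree fin hom); apply/(infE fin hom d1).
  have rX : (Posz (k + l) <= degree S (delta S) * r)%R.
    by rewrite -dX -(degreeD fin hom); apply: (le_degree fin hom); apply/(supE fin hom d1).
  split.
    apply/(infgeE fin hom d1); apply: contrapT => pN.
    apply: (@infge_contra _ _ fin hom X p r g t) => [j||].
    - move/(infgeE fin hom d1); rewrite -sg; have [-> _] := ex j; rewrite /p; lia.
    - by rewrite /p /r; nia.
    - by apply: (infge_mono fin hom d1 _ rt1); rewrite /p; lia.
  apply/(supleE fin hom d1); apply: contrapT => rN.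
  (* The bound on sup is the bound on inf for [X^-1], with [p], [r] replaced by [- r], [- p];
     sliding is invariant under this duality. *)
  have sigV h : sig S X^-1 (- r)%R (- p)%R h = sig S X p r h.
    by rewrite /sig invgK opprK meetC.
  apply: (@infge_contra _ _ fin hom X^-1 (- r)%R (- p)%R g t) => [j||].
  - rewrite (eq_iter sigV) (_ : - r + 1 = - (r - 1))%R; last by lia.
    by move/(supleE fin hom d1); rewrite -sg; have [_ ->] := ex j; rewrite /r /p; lia.
  - by rewrite /p /r in pX rX rN *; nia.
  - by apply: (infge_mono fin hom d1 _ rt2); rewrite /r /p in rN *; lia.
case=> [[x1 [y1 [[[w _ <-] _] [[v _ <-] _] [z _ <-]]]]|H].
  apply: mulJ; exists ((x ^+ k) ^ w); first by exists w.
  by exists ((y ^+ l) ^ v); [exists v | rewrite !conjXg].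
(* The condition on all circuits has content because circuits exist; one product form in an orbit
   exhibits a conjugate of [X] in the product of classes. *)
have [Y cY] := sliding_circuit_exists fin hom d1 X.
have [[Z [i _ iE] pf] _] := H Y cY.
case: pf => [n [x1 [y1 [A [B [n0 [[w _ wE] _] [[v _ vE] _] AB /lnfE[ZE _]]]]]]].
have [V VE] := sandwich_conj k x1 AB.
have cZ : set_mulg (conj_class (x ^+ k)) (conj_class (y ^+ l)) Z.
  exists ((x ^+ k) ^ (w * V)); first by exists (w * V).
  exists ((y ^+ l) ^ v); first by exists v.
  by rewrite ZE big_cat /= [RHS]mulgA VE big_nseq iter_mulg_1 conjgM !conjXg wE vE.
have [c _ cE] : conj_class X Z.
  case: cY => cXY _; apply: conj_class_trans cXY _; rewrite -iE.
  elim: i {iE} => [|i [u _ E]] /=; first by exists 1 => //; rewrite conjg1.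
  rewrite -E /cycling; case: ifP => _; last exact: conj_classJ.
  by rewrite -conjgM; exact: conj_classJ.
by rewrite -[X](conjgK c) cE; exact: mulJ.
Qed.
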